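(* Let $\sigma>0$, $\alpha\ge2$, $\rho\in(0,2]$. Suppose that the KKT system $$-B_1^*x^*\in\partial f_1(y^* ),\qquad -B_2^*x^*\in\partial f_2(z^* ),\qquad B_1y^*+B_2z^*-c=0$$ has a nonempty solution set, and that both $\Sigma_{f_1}+B_1^*B_1+\mathcal{T}_1$ and $\Sigma_{f_2}+B_2^*B_2+\mathcal{T}_2$ are positive definite. Then the sequence $\{\bar w^k\}=\{(\bar y^k,\bar z^k,\bar x^k)\}$ generated by the accelerated preconditioned ADMM (accelerated pADMM) described in the context converges to a point $w^*=(y^*,z^*,x^* )$, where $(y^*,z^* )$ is a solution to the primal problem $$\min_{y\in\mathbb{Y},z\in\mathbb{Z}} f_1(y)+f_2(z)\quad\text{subject to }B_1y+B_2z=c$$ and $x^*$ is a solution to the dual problem $$\max_{x\in\mathbb{X}}\{-f_1^*(-B_1^*x)-f_2^*(-B_2^*x)-\langle c,x\rangle\}.$$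
   Context: Setting. $\mathbb{X},\mathbb{Y},\mathbb{Z}$ are finite-dimensional real Euclidean spaces, $\mathbb{W}:=\mathbb{Y}\times\mathbb{Z}\times\mathbb{X}$, $w=(y,z,x)$. $f_1:\mathbb{Y}\to(-\infty,+\infty]$ and $f_2:\mathbb{Z}\to(-\infty,+\infty]$ are proper closed convex functions with Fenchel conjugates $f_1^*,f_2^*$; $B_1:\mathbb{Y}\to\mathbb{X}$ and $B_2:\mathbb{Z}\to\mathbb{X}$ are linear with adjoints $B_1^*,B_2^*$; $c\in\mathbb{X}$. $\mathcal{T}_1$ and $\mathcal{T}_2$ are self-adjoint positive semidefinite linear operators on $\mathbb{Y}$ and $\mathbb{Z}$. For a self-adjoint positive semidefinite operator $\mathcal{S}$, $\|v\|_{\mathcal{S}}:=\sqrt{\langle v,\mathcal{S}v\rangle}$. $\Sigma_{f_1}$ and $\Sigma_{f_2}$ are self-adjoint positive semidefinite operators (which exist by convexity) such that for all $y,\hat y\in\operatorname{dom}(f_1)$, $\phi\in\partial f_1(y)$, $\hat\phi\in\partial f_1(\hat y)$: $f_1(y)\ge f_1(\hat y)+\langle\hat\phi,y-\hat y\rangle+\frac12\|y-\hat y\|^2_{\Sigma_{f_1}}$ and $\langle\phi-\hat\phi,y-\hat y\rangle\ge\|y-\hat y\|^2_{\Sigma_{f_1}}$; and similarly for $f_2$ and $\Sigma_{f_2}$ on $\mathbb{Z}$. Augmented Lagrangian: $L_\sigma(y,z;x)=f_1(y)+f_2(z)+\langle x,B_1y+B_2z-c\rangle+\frac{\sigma}{2}\|B_1y+B_2z-c\|^2$.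 Accelerated pADMM: choose $w^0=(y^0,z^0,x^0)\in\operatorname{dom}(f_1)\times\operatorname{dom}(f_2)\times\mathbb{X}$, set $\hat w^0=w^0$. For $k=0,1,\ldots$, with $\bar w^k=(\bar y^k,\bar z^k,\bar x^k)$: 1. $\bar z^k=\arg\min_{z\in\mathbb{Z}}\{L_\sigma(y^k,z;x^k)+\frac12\|z-z^k\|^2_{\mathcal{T}_2}\}$; 2. $\bar x^k=x^k+\sigma(B_1y^k+B_2\bar z^k-c)$; 3. $\bar y^k=\arg\min_{y\in\mathbb{Y}}\{L_\sigma(y,\bar z^k;\bar x^k)+\frac12\|y-y^k\|^2_{\mathcal{T}_1}\}$; 4. $\hat w^{k+1}=(1-\rho)w^k+\rho\bar w^k$; 5. $w^{k+1}=w^k+\frac{\alpha}{2(k+\alpha)}(\hat w^{k+1}-w^k)+\frac{k}{k+\alpha}(\hat w^{k+1}-\hat w^k)$.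
   Formalization: In step 1 the z-independent term f_1(y^k) of L_sigma is dropped: extrapolation may move y^k out of dom(f_1), where the literal objective is identically +infinity and the argmin is undefined; when f_1(y^k) is finite the minimizers are the same. *)

(* Defs.v *)
From HB Require Import structures.
From mathcomp Require Import all_boot all_order all_algebra.
From mathcomp Require Import all_classical all_reals all_analysis.

Set Implicit Arguments.
Unset Strict Implicit.
Unset Printing Implicit Defensive.

Import Order.TTheory GRing.Theory Num.Theory.
Import numFieldNormedType.Exports.

Local Open Scope classical_set_scope.
Local Open Scope ring_scope.

#[short(type="normedVectType")]
HB.structure Definition NormedVector (R : realType) :=
  {E of NormedModule R E & Vector R E}.

HB.mixin Record NormedVector_isEuclidean (R : realType) E
    of NormedModule R E & Vector R E := {
  inner : {dot E for idfun};
  normr_inner : forall u : E, `|u| = Num.sqrt (inner u u)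
}.

(* A finite-dimensional real inner product space, whose norm (hence topology)
   is the one induced by the inner product. *)
#[short(type="euclideanType")]
HB.structure Definition Euclidean (R : realType) :=
  {E of NormedVector_isEuclidean R E & NormedModule R E & Vector R E}.

Notation "''[' u , v ]" := (inner u v) : ring_scope.

Section Operators.
Context {R : realType}.

Definition adjoint {E F : euclideanType R} (B : E -> F) (Bs : F -> E) : Prop :=
  forall u v, '[B u, v] = '[u, Bs v].

Definition selfadjoint {E : euclideanType R} (S : E -> E) : Prop := adjoint S S.

Definition possemidef {E : euclideanType R} (S : E -> E) : Prop :=
  selfadjoint S /\ forall v, 0 <= '[v, S v].

Definition posdef {E : euclideanType R} (S : E -> E) : Prop :=
  selfadjoint S /\ forall v, v != 0 -> 0 < '[v, S v].

Definition opnorm {E : euclideanType R} (S : E -> E) (v : E) : R :=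
  Num.sqrt '[v, S v].

End Operators.

Section ConvexAnalysis.
Context {R : realType} {E : euclideanType R}.
Implicit Types f : E -> \bar R.
Local Open Scope ereal_scope.

Definition dom f : set E := [set u | f u < +oo].

Definition proper_fun f : Prop := (forall u, -oo < f u) /\ dom f !=set0.

Definition convex_fun f : Prop := forall (u v : E) (t : R), (0 <= t <= 1)%R ->
  f (t *: u + (1 - t) *: v)%R <= t%:E * f u + (1 - t)%:E * f v.

Definition proper_closed_convex f : Prop :=
  [/\ proper_fun f, lower_semicontinuous f & convex_fun f].

Definition subdiff f (u : E) : set E :=
  [set phi | forall v, f u + '[phi, (v - u)%R]%:E <= f v].

Definition conjugate f (s : E) : \bar R :=
  ereal_sup (range (fun u => '[s, u]%:E - f u)).

Definition argmin f : set E := [set u | forall v, f u <= f v].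

Definition convexity_modulus f (Sigma : E -> E) : Prop :=
  possemidef Sigma /\
  forall u v phi psi, dom f u -> dom f v -> subdiff f u phi -> subdiff f v psi ->
    f v + ('[psi, (u - v)%R] + 2^-1 * opnorm Sigma (u - v) ^+ 2)%:E <= f u /\
    (opnorm Sigma (u - v) ^+ 2 <= '[(phi - psi)%R, (u - v)%R])%R.

End ConvexAnalysis.

Section Problem.
Context {R : realType} {X Y Z : euclideanType R}.
Variables (f1 : Y -> \bar R) (f2 : Z -> \bar R).
Variables (B1 : Y -> X) (B2 : Z -> X) (c : X).
Local Open Scope ereal_scope.

Definition primal_solution (y : Y) (z : Z) : Prop :=
  (B1 y + B2 z)%R = c /\
  forall y' z', (B1 y' + B2 z')%R = c -> f1 y + f2 z <= f1 y' + f2 z'.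

Definition dual_objective (B1s : X -> Y) (B2s : X -> Z) (x : X) : \bar R :=
  - conjugate f1 (- B1s x)%R - conjugate f2 (- B2s x)%R - '[c, x]%:E.

Definition dual_solution (B1s : X -> Y) (B2s : X -> Z) (x : X) : Prop :=
  forall x', dual_objective B1s B2s x' <= dual_objective B1s B2s x.

Definition KKT (B1s : X -> Y) (B2s : X -> Z) (y : Y) (z : Z) (x : X) : Prop :=
  [/\ subdiff f1 y (- B1s x)%R, subdiff f2 z (- B2s x)%R
    & (B1 y + B2 z - c = 0)%R].

Definition aug_lagrangian (sigma : R) (y : Y) (z : Z) (x : X) : \bar R :=
  f1 y + f2 z +
  ('[x, (B1 y + B2 z - c)%R] + sigma / 2 * `|B1 y + B2 z - c| ^+ 2)%:E.

End Problem.

Section Algorithm.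
Context {R : realType} {X Y Z : euclideanType R}.
Variables (f1 : Y -> \bar R) (f2 : Z -> \bar R).
Variables (B1 : Y -> X) (B2 : Z -> X) (c : X) (T1 : Y -> Y) (T2 : Z -> Z).
Variables (sigma alpha rho : R).

(* In the z-subproblem the constant term f1 (y k) of the augmented Lagrangian
   is replaced by 0: the extrapolation may move y k out of dom f1, where this
   constant is +oo and would make every z a minimizer. *)
Definition accelerated_pADMM (w wbar what : nat -> Y * Z * X) : Prop :=
  [/\ dom f1 (w 0).1.1, dom f2 (w 0).1.2, what 0 = w 0 &
   forall k,
    let: (y, z, x) := w k in
    let: (ybar, zbar, xbar) := wbar k in
    [/\ argmin (fun z' => aug_lagrangian (cst 0%E) f2 B1 B2 c sigma y z' x
                          + (2^-1 * opnorm T2 (z' - z) ^+ 2)%:E)%E zbar,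
        xbar = x + sigma *: (B1 y + B2 zbar - c),
        argmin (fun y' => aug_lagrangian f1 f2 B1 B2 c sigma y' zbar xbar
                          + (2^-1 * opnorm T1 (y' - y) ^+ 2)%:E)%E ybar,
        what k.+1 = (1 - rho) *: w k + rho *: wbar k
      & w k.+1 = w k + (alpha / (2 * (k%:R + alpha))) *: (what k.+1 - w k)
                     + (k%:R / (k%:R + alpha)) *: (what k.+1 - what k)]].

End Algorithm.

(* Main.v *)
(* The scheme is a relaxed, accelerated proximal point iteration for the KKT
   operator, in the degenerate metric M of [form]: writing P for the relaxed
   resolvent, which is M-nonexpansive, F_k = w^k - P w^k and
   e_k = w^{k+1} - P w^k, the recurrence becomes
     (k + alpha) e_k = k e_{k-1} + (alpha / 2) F_k.
   Nonexpansiveness propagates |F_k|^2 <= 2 <F_k, e_k> and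
   |F_{k+1}|^2 <= 2 <F_{k+1}, e_k>, so |F_{k+1}| <= 2 |e_k|, and F_k -> 0 as soon
   as k e_{k-1} is bounded.
   With G_k = k e_{k-1} and a_k = w^k - p for a fixed point p, the quantities
     (alpha - 1) lambda |a_k|^2 + 2 lambda <a_k, G_k> + |G_k|^2
   for lambda = alpha / 2 and lambda = alpha - 1 are nonincreasing. If alpha > 2,
   subtracting them shows that |G_k| converges, and sum |G_k|^2 / k < oo forces
   G_k -> 0, so that |a_k| converges: Opial's argument concludes. If alpha = 2,
   G_k + w^k is constantly w^0 (Halpern's iteration), and averaging the
   one-step estimate gives
     limsup |w^k - p|^2 <= |w^0 - p|^2 - liminf |w^0 - w^k|^2,
   which vanishes for the cluster point p realizing the lower limit.
   The positive definiteness assumptions make the resolvent Lipschitz from the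
   M-seminorm to the norm, which yields the boundedness of the resolvents, hence
   cluster points, and finally transfers the convergence to them. *)

Require Import Defs.
From HB Require Import structures.
From mathcomp Require Import all_boot all_order all_algebra.
From mathcomp Require Import all_classical all_reals all_analysis.
From mathcomp Require Import ring lra.

Set Implicit Arguments.
Unset Strict Implicit.
Unset Printing Implicit Defensive.

Import Order.TTheory GRing.Theory Num.Theory.
Import numFieldNormedType.Exports.

Local Open Scope classical_set_scope.
Local Open Scope ring_scope.

(** * Real sequences *)

Section RealSequences.
Context {R : realType}.
Implicit Types E c u : nat -> R.

Lemma cvg_decreasing_nonneg E : (forall k, 0 <= E k) ->
  (forall k, E k.+1 <= E k) -> cvgn E.
Proof.
move=> E0 ES; apply: nonincreasing_is_cvgn; first exact/nonincreasing_seqP.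
by exists 0 => _ [k _ <-].
Qed.

Lemma cvg_index (f : nat -> nat) : (forall n, (n <= f n)%N) -> f @ \oo --> \oo.
Proof.
move=> fn A [N _ NA]; exists N => // n Nn; apply: NA => /=.
exact: leq_trans (fn n).
Qed.

Lemma cvg0_sqr_le u c : (forall n, u n ^+ 2 <= c n) ->
  c @ \oo --> 0 -> u @ \oo --> 0.
Proof.
move=> uc c0; apply/cvgrPdist_lt => eps eps0.
have : \forall k \near \oo, c k < eps ^+ 2 by apply: cvgr_lt c0 _ _; rewrite exprn_gt0.
apply: filterS => n cn; rewrite sub0r normrN.
by rewrite -(@ltr_pXn2r _ 2) ?nnegrE ?(ltW eps0)// real_normK ?num_real// (le_lt_trans (uc n)).
Qed.

(** If the limit were positive, the drops of [E] would eventually dominate a multiple of the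
    divergent harmonic series, while [E] stays nonnegative. *)
Lemma harmonic_weight_null E c (kappa l : R) : 0 < kappa ->
  (forall k, 0 <= E k) -> (forall k, 0 <= c k) ->
  (forall k, E k.+1 + kappa * (c k.+1 / k.+1%:R) <= E k) ->
  c @ \oo --> l -> l = 0.
Proof.
move=> kappa0 E0 c0 ES cl.
have l0 : 0 <= l by apply: (cvgr_to_ge cl); exact: nearW.
apply/eqP; rewrite eq_le l0 andbT leNgt; apply/negP => {}l0.
apply: (@dvg_harmonic R).
have [N _ cN] : \forall k \near \oo, l / 2 < c k.
  by apply: cvgr_gt cl _ _; lra.
pose d := kappa * (l / 2); have d0 : 0 < d by rewrite mulr_gt0//; lra.
have B n : E (N + n)%N + d * series harmonic (N + n)%N <= E N + d * series harmonic N.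
  elim: n => [|n IH]; first by rewrite addn0.
  apply: le_trans IH; rewrite addnS seriesSr.
  have cNn : l / 2 < c (N + n).+1 by apply: cN; rewrite /= leqW ?leq_addr.
  have := ES (N + n)%N; rewrite /=.
  set h := _^-1.
  have h0 : 0 < kappa * h by rewrite mulr_gt0// invr_gt0 ltr0n.
  have := ler_wpM2l (ltW h0) (ltW cNn); rewrite /d; lra.
apply: nondecreasing_is_cvgn.
  by apply/nondecreasing_seqP => n; rewrite seriesSr lerDl invr_ge0.
exists (E N / d + series harmonic N) => _ [n _ <-].
have : series (@harmonic R) n <= series harmonic (N + n)%N.
  rewrite (@nondecreasing_series _ _ xpredT)//; last exact: leq_addl.
  by move=> i; rewrite invr_ge0.
move/le_trans; apply.
rewrite -(ler_pM2l d0) mulrDr mulrCA divff ?gt_eqF// mulr1.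
have := B n; have := E0 (N + n)%N; lra.
Qed.

(** [l] is the lower limit, built as the supremum of the eventual lower bounds. A subsequence is an
    index map with [n <= f n], not necessarily increasing: this suffices for limits and is stable
    under composition. *)
Lemma liminf_subseq u (C : R) : (forall k, 0 <= u k <= C) ->
  exists l (f : nat -> nat), [/\ forall n, (n <= f n)%N, u \o f @ \oo --> l
    & forall eps, 0 < eps -> \forall k \near \oo, l - eps <= u k].
Proof.
move=> uC; pose S := [set x | \forall k \near \oo, x <= u k].
have S0 : S 0 by apply: nearW => k; have /andP[] := uC k.
have SC : ubound S C.
  move=> x [N _ xN]; apply: le_trans (xN N (leqnn N)) _.
  by have /andP[] := uC N.
have supS : has_sup S by split; [exists 0|exists C].
have low eps : 0 < eps -> \forall k \near \oo, sup S - eps <= u k.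
  move=> eps0; have [x Sx xS] := sup_adherent eps0 supS.
  by apply: filterS Sx => k; apply: le_trans; exact: ltW.
have high n : exists k, (n <= k)%N /\ u k < sup S + n.+1%:R^-1.
  apply: contrapT => /forallNP H.
  have /(ub_le_sup supS.2) : S (sup S + n.+1%:R^-1).
    exists n => // k nk; rewrite leNgt; apply/negP => uk.
    exact: (H k).
  by apply/negP; rewrite -ltNge ltrDl invr_gt0 ltr0n.
have [f fP] := choice high.
exists (sup S), f; split => //; first by move=> n; have [] := fP n.
have fN := cvg_index (fun n => (fP n).1).
apply/cvgrPdist_le => eps eps0.
have [e1 e2] : (\forall n \near \oo, sup S - eps <= u (f n)) /\
    \forall n \near \oo, n.+1%:R^-1 <= eps.
  split; first exact: fN (low _ eps0).
  have /cvgr_lt/(_ _ eps0) := @cvg_harmonic R.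
  by apply: filterS => n /ltW.
near=> n; rewrite ler_distlC; apply/andP; split; first by near: n.
apply: le_trans (ltW (fP n).2) _; rewrite lerD2l.
by near: n.
Unshelve. all: by end_near. Qed.

Lemma cesaro_null (A s : nat -> R) :
  (forall k, 0 <= A k) -> (forall k, A k.+1 <= A k + s k) ->
  (forall eps, 0 < eps -> \forall k \near \oo, s k <= eps) ->
  (fun k => A k / k.+1%:R) @ \oo --> (0 : R).
Proof.
move=> A0 AS sN; apply/cvgrPdist_le => eps eps0.
have [N _ Ns] := sN _ (divr_gt0 eps0 (ltr0n R 2)).
have B n : A (N + n)%N <= A N + n%:R * (eps / 2).
  elim: n => [|n IH]; first by rewrite addn0 mul0r addr0.
  rewrite addnS -natr1; have := AS (N + n)%N.
  by have /= := Ns (N + n)%N (leq_addr _ _); lra.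
(* Past this threshold the initial value [A N] costs at most [k * (eps / 2)]; the increments cost
   the other half. *)
have : \forall k \near \oo, 2 * A N / eps <= k%:R by exact: nbhs_infty_ger.
move=> [M _ kM]; exists (maxn N M) => // k /=; rewrite geq_max => /andP[Nk Mk].
rewrite sub0r normrN ger0_norm ?divr_ge0// ler_pdivrMr ?ltr0n//.
have := B (k - N)%N; rewrite subnKC//; move/le_trans; apply.
have /= := kM k Mk; rewrite ler_pdivrMr// => H.
have : (k - N)%:R <= k%:R :> R by rewrite ler_nat leq_subr.
rewrite -(natr1 k) => Hk.
have := ler_wpM2r (ltW (divr_gt0 eps0 (ltr0n R 2))) Hk.
by lra.
Qed.

End RealSequences.

(** * The accelerated fixed-point iteration in a seminormed space *)

Section FastKrasnoselskiiMann.
Context {R : realType} {W : lmodType R}.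
Variable q : W -> W -> R.
Hypothesis qC : forall u v, q u v = q v u.
Hypothesis qDl : forall u v t, q (u + v) t = q u t + q v t.
Hypothesis qZl : forall c u v, q (c *: u) v = c * q u v.
Hypothesis q_ge0 : forall u, 0 <= q u u.

Lemma qDr u v t : q t (u + v) = q t u + q t v.
Proof. by rewrite qC qDl !(qC t). Qed.

Lemma qZr c u v : q v (c *: u) = c * q v u.
Proof. by rewrite qC qZl qC. Qed.

Lemma qNl u v : q (- u) v = - q u v.
Proof. by rewrite -scaleN1r qZl mulN1r. Qed.

Lemma qNr u v : q v (- u) = - q v u.
Proof. by rewrite qC qNl qC. Qed.

Lemma q0r u : q u 0 = 0.
Proof. by rewrite -(scale0r 0) qZr mul0r. Qed.

Definition qE := (qDl, qDr, qNl, qNr, qZl, qZr).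

Lemma q_cauchy_schwarz u v : q u v ^+ 2 <= q u u * q v v.
Proof.
have H t : 0 <= q u u - 2 * t * q u v + t ^+ 2 * q v v.
  have := q_ge0 (u - t *: v); rewrite !qE (qC v u).
  by congr (_ <= _); ring.
have := q_ge0 v; rewrite le_eqVlt => /predU1P[v0|v0].
  have [->|uv0] := eqVneq (q u v) 0; first by rewrite -v0 expr0n mulr0.
  (* The form may be degenerate: for [q v v = 0] the quadratic is affine in [t], and this [t] gives
     it the value -1. *)
  have := H ((q u u + 1) / (2 * q u v)); rewrite -v0 mulr0 addr0.
  have -> : 2 * ((q u u + 1) / (2 * q u v)) * q u v = q u u + 1 by field.
  by lra.
have := H (q u v / q v v).
have -> : q u u - 2 * (q u v / q v v) * q u v + (q u v / q v v) ^+ 2 * q v v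
  = (q u u * q v v - q u v ^+ 2) / q v v by field; rewrite gt_eqF.
by rewrite pmulr_lge0 ?invr_gt0// subr_ge0.
Qed.

Lemma cvg_q_sqr (u : nat -> W) p :
  (fun n => q (u n - p) (u n - p)) @ \oo --> (0 : R) ->
  (fun n => q (u n) (u n)) @ \oo --> q p p.
Proof.
move=> up.
have up2 : (fun n => q (u n - p) p) @ \oo --> (0 : R).
  apply: (@cvg0_sqr_le _ _ (fun n => q (u n - p) (u n - p) * q p p)).
    by move=> n; exact: q_cauchy_schwarz.
  by rewrite -[0](mul0r (q p p)); apply: cvgMr_tmp.
have -> : (fun n => q (u n) (u n))
   = (fun n => q (u n - p) (u n - p) + 2 * q (u n - p) p + q p p).
  by apply/funext => n; rewrite !qE (qC p (u n)); ring.
rewrite -[q p p in X in _ --> X]add0r -[0 in X in _ --> X]addr0.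
rewrite -[X in 0 + X + _](mulr0 2).
by apply: cvgD; [apply: cvgD => //; exact: cvgMl_tmp|exact: cvg_cst].
Qed.

(* [F k] is the residual [w k - P (w k)] of a nonexpansive map [P],
   [e k = w k.+1 - P (w k)] and [G k = k e (k - 1)]. *)
Variables (alpha : R) (w F e G : nat -> W).
Hypothesis alpha_ge2 : 2 <= alpha.
Hypothesis wS : forall k, w k.+1 = w k - F k + e k.
Hypothesis G0 : G 0%N = 0.
Hypothesis GS : forall k, G k.+1 = k.+1%:R *: e k.
Hypothesis GE : forall k, G k = (k%:R + alpha) *: e k - (alpha / 2) *: F k.
(** This is [|P u - P v|^2 <= |u - v|^2] for [P = id - F] at consecutive iterates, expanded so that
    only residuals occur. *)
Hypothesis F_coco : forall k,
  q (F k.+1 - F k) (F k.+1 - F k) <= 2 * q (F k.+1 - F k) (w k.+1 - w k).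

Let k_alpha_gt0 (k : nat) : 0 < k%:R + alpha.
Proof. by rewrite ltr_wpDl ?ler0n// (lt_le_trans _ alpha_ge2). Qed.

(** The two inequalities are proved alternately: [coco] turns the first into the second by
    nonexpansiveness, and [now] uses the recurrence for [G] to reach the first at the next index. *)
Lemma residual_step k :
  q (F k) (F k) <= 2 * q (F k) (e k) /\
  q (F k.+1) (F k.+1) <= 2 * q (F k.+1) (e k).
Proof.
have coco j : q (F j) (F j) <= 2 * q (F j) (e j) ->
    q (F j.+1) (F j.+1) <= 2 * q (F j.+1) (e j).
  move=> H; have := F_coco j.
  have -> : w j.+1 - w j = e j - F j by rewrite wS addrAC [w j - F j]addrC addrK addrC.
  rewrite !qE (qC (F j) (F j.+1)). lra.
have now j : j%:R * q (F j) (F j) <= 2 * q (F j) (G j) ->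
    q (F j) (F j) <= 2 * q (F j) (e j).
  rewrite GE !qE => H.
  rewrite -(ler_pM2l (k_alpha_gt0 j)). lra.
have {now} : q (F k) (F k) <= 2 * q (F k) (e k).
  elim: k => [|k IH]; apply: now; first by rewrite mul0r G0 q0r mulr0.
  by rewrite GS qZr mulrCA ler_wpM2l ?ler0n//; exact: coco.
by move=> H; split => //; exact: coco.
Qed.

Lemma residual_cvg0 C : (forall k, q (G k) (G k) <= C) ->
  (fun k => q (F k) (F k)) @ \oo --> (0 : R).
Proof.
move=> GC; rewrite -(cvg_shiftS (fun k => q (F k) (F k))).
have FC k : q (F k.+1) (F k.+1) <= 4 * C * k.+1%:R^-1.
  have k0 : 0 < k.+1%:R :> R by rewrite ltr0n.
  have k1 : 1 <= k.+1%:R :> R by rewrite ler1n.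
  rewrite ler_pdivlMr//.
  have := (residual_step k).2; have := q_ge0 (F k.+1 - 2 *: e k).
  have := GC k.+1; rewrite GS !qE (qC (e k) (F k.+1)) => Gk H1 H2.
  have F4 : q (F k.+1) (F k.+1) <= 4 * q (e k) (e k) by lra.
  (* One of the two factors [k.+1] in [q (G k.+1) (G k.+1)] is given up; the remaining rate
     [1 / k.+1] is enough. *)
  have E1 : k.+1%:R * q (e k) (e k) <= C.
    by apply: le_trans Gk; rewrite ler_pM2l// ler_peMl.
  by nra.
apply: (@squeeze_cvgr _ _ _ _ (fun=> 0) (fun k => 4 * C * k.+1%:R^-1)).
- by near=> n; rewrite q_ge0 FC.
- exact: cvg_cst.
- rewrite -[0 in X in _ --> X](mulr0 (4 * C)); apply: cvgMl_tmp.
  exact: cvg_harmonic.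
Unshelve. all: by end_near. Qed.


(** * Energy estimates around a fixed point *)

Section FixedPoint.
Variable p : W.
Hypothesis F_fix : forall k, q (F k) (F k) <= 2 * q (F k) (w k - p).

Let a k := q (w k - p) (w k - p).
Let b k := q (w k - p) (G k).
Let c k := q (G k) (G k).

(* Equal to [|lambda (w k - p) + G k|^2 + lambda (alpha - 1 - lambda) |w k - p|^2],
   hence nonnegative for [0 <= lambda <= alpha - 1]. *)
Definition energy (lambda : R) k :=
  (alpha - 1) * lambda * a k + 2 * lambda * b k + c k.

Let expand k : [/\ a k.+1 = a k + q (F k) (F k) + q (e k) (e k) - 2 * q (F k) (w k - p)
      + 2 * q (e k) (w k - p) - 2 * q (F k) (e k),
  b k.+1 = k.+1%:R * (q (e k) (w k - p) - q (F k) (e k) + q (e k) (e k)),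
  b k = (k%:R + alpha) * q (e k) (w k - p) - alpha / 2 * q (F k) (w k - p),
  c k.+1 = k.+1%:R ^+ 2 * q (e k) (e k) &
  c k = (k%:R + alpha) ^+ 2 * q (e k) (e k)
      - (k%:R + alpha) * alpha * q (F k) (e k) + (alpha / 2) ^+ 2 * q (F k) (F k)].
Proof.
rewrite /a /b /c.
have -> : w k.+1 - p = (w k - p) - F k + e k.
  by rewrite wS addrAC; congr (_ + _); rewrite addrAC.
rewrite GS GE; move: (w k - p) => x.
by split; rewrite !qE ?(qC x) ?(qC (e k) (F k)); field.
Qed.


(** At [lambda = alpha / 2] the products [q (F k) (e k)] cancel in the energy difference. The extra
    term on the left is [(alpha - 2) * c k.+1 / k.+1], which later forces [c] to vanish in the
    limit. *)
Lemma energy_half_decr k :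
  energy (alpha / 2) k.+1 + (alpha - 2) * k.+1%:R * q (e k) (e k)
    <= energy (alpha / 2) k.
Proof.
rewrite /energy; have [-> -> -> -> ->] := expand k.
rewrite -natr1 -subr_ge0 [leRHS](_ : _ = (alpha - 2) *
    (alpha / 4 * (2 * q (F k) (w k - p) - q (F k) (F k))
     + (alpha - 1) / 2 * q (e k) (e k))); last by field.
have := F_fix k; rewrite -subr_ge0 => Fk.
move: alpha_ge2; rewrite -subr_ge0 => a2.
rewrite mulr_ge0// addr_ge0// mulr_ge0 ?q_ge0//; lra.
Qed.

(** At [lambda = alpha - 1] the squares [q (e k) (e k)] cancel instead; the remaining product
    [q (F k) (e k)] is controlled by [residual_step]. *)
Lemma energy_decr k : energy (alpha - 1) k.+1 <= energy (alpha - 1) k.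
Proof.
have [HF _] := residual_step k.
rewrite /energy; have [-> -> -> -> ->] := expand k.
rewrite -natr1 -subr_ge0 [leRHS](_ : _ = (alpha - 2) *
    ((alpha - 1) / 2 * (2 * q (F k) (w k - p) - q (F k) (F k))
     + (k%:R + alpha) / 2 * (2 * q (F k) (e k) - q (F k) (F k))
     + (2 * k%:R + alpha) / 4 * q (F k) (F k))); last by field.
have := F_fix k; rewrite -subr_ge0 => Fk.
move: HF; rewrite -subr_ge0 => HF.
have k0 := ler0n R k.
move: alpha_ge2; rewrite -subr_ge0 => a2.
rewrite mulr_ge0// !addr_ge0// mulr_ge0 ?q_ge0//; lra.
Qed.

Lemma energy_half_lower k : (alpha - 2) * alpha / 4 * a k <= energy (alpha / 2) k.
Proof.
rewrite /energy /a /b /c; move: (w k - p) => x.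
have := q_ge0 ((alpha / 2) *: x + G k); rewrite !qE (qC (G k)) => H; lra.
Qed.

Lemma energy_ge0 k : 0 <= energy (alpha - 1) k.
Proof.
rewrite /energy /a /b /c; move: (w k - p) => x.
have := q_ge0 ((alpha - 1) *: x + G k); rewrite !qE (qC (G k)) => H; lra.
Qed.

Lemma dist_le k : 2 < alpha ->
  a k <= energy (alpha / 2) 0%N * (4 / ((alpha - 2) * alpha)).
Proof.
move=> alpha2.
have E0 : energy (alpha / 2) k <= energy (alpha / 2) 0%N.
  elim: k => [//|k]; apply: le_trans; apply: le_trans (energy_half_decr k).
  by rewrite lerDl mulr_ge0// mulr_ge0 ?ler0n// subr_ge0 ltW.
have := le_trans (energy_half_lower k) E0.
have d0 : 0 < (alpha - 2) * alpha / 4 by rewrite !mulr_gt0//; lra.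
rewrite mulrC -ler_pdivlMr//; move/le_trans; apply.
by rewrite invf_div.
Qed.

Lemma cvg_dist : 2 < alpha -> c @ \oo --> (0 : R) /\ cvgn a.
Proof.
move=> alpha2.
have halfS k : (alpha - 2) * (c k.+1 / k.+1%:R) = (alpha - 2) * k.+1%:R * q (e k) (e k).
  rewrite /c GS qZl qZr; field; by rewrite addrC natr1 pnatr_eq0.
have lower k : 0 <= energy (alpha / 2) k.
  apply: le_trans (energy_half_lower k).
  by rewrite !mulr_ge0 ?q_ge0//; lra.
have /cvg_ex[l1 E1] : cvgn (energy (alpha / 2)).
  apply: cvg_decreasing_nonneg => // k; apply: le_trans (energy_half_decr k).
  by rewrite lerDl mulr_ge0 ?q_ge0// mulr_ge0 ?ler0n//; lra.
have /cvg_ex[l2 E2] : cvgn (energy (alpha - 1)).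
  by apply: cvg_decreasing_nonneg; [exact: energy_ge0|exact: energy_decr].
(* Both energies are affine in [lambda] with constant term [c k], so this quotient is their slope,
   and [c] is recovered as the intercept. *)
pose d k := (energy (alpha - 1) k - energy (alpha / 2) k) * (alpha / 2 - 1)^-1.
have dE k : d k = (alpha - 1) * a k + 2 * b k.
  by rewrite /d /energy; field; rewrite subr_eq0 gt_eqF.
have dl : d @ \oo --> (l2 - l1) * (alpha / 2 - 1)^-1 by apply: cvgMr_tmp; exact: cvgB.
set l := (l2 - l1) * _ in dl.
have c0 : c @ \oo --> (0 : R).
  have cl : c @ \oo --> l1 - alpha / 2 * l.
    rewrite (_ : c = fun k => energy (alpha / 2) k - alpha / 2 * d k).
      by apply: cvgB => //; exact: cvgMl_tmp.
    by apply/funext => k; rewrite dE /energy; ring.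
  rewrite -(@harmonic_weight_null _ (energy (alpha / 2)) c (alpha - 2) _ _ _ _ _ cl)//;
    first by rewrite subr_gt0.
    by move=> k; exact: q_ge0.
  by move=> k; rewrite halfS; exact: energy_half_decr.
split => //.
have b0 : b @ \oo --> (0 : R).
  pose C := energy (alpha / 2) 0%N * (4 / ((alpha - 2) * alpha)).
  apply: (@cvg0_sqr_le _ _ (fun k => C * c k)).
    move=> k; apply: le_trans (q_cauchy_schwarz _ _) _.
    by rewrite ler_wpM2r ?q_ge0// dist_le.
  by rewrite -[0](mulr0 C); exact: cvgMl_tmp.
apply/cvg_ex; exists ((l - 2 * 0) * (alpha - 1)^-1).
rewrite (_ : a = fun k => (d k - 2 * b k) * (alpha - 1)^-1).
  by apply: cvgMr_tmp; apply: cvgB => //; exact: cvgMl_tmp.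
apply/funext => k; rewrite dE; field.
by rewrite subr_eq0 gt_eqF//; lra.
Qed.

(** With [alpha = 2], [GS] and [GE] give [G k.+1 - G k = F k - e k], which is [w k - w k.+1]. *)
Lemma halpern_anchor k : alpha = 2 -> G k + w k = w 0%N.
Proof.
move=> alpha2; elim: k => [|k <-]; first by rewrite G0 add0r.
rewrite GS GE wS alpha2 divff ?pnatr_eq0// scale1r.
rewrite (_ : k%:R + 2 = k.+1%:R + 1); last by rewrite -(natr1 k); ring.
rewrite scalerDl scale1r -!addrA; congr (_ + _).
by rewrite addrC -addrA addrCA.
Qed.

(* The anchor [G k + w k] stays at [w 0], so that [w k.+1] is the average of
   [w 0] with weight [1 / (k + 2)] and of the image of [w k]. *)
Lemma halpern_step k : alpha = 2 ->
  k.+2%:R * a k.+1 <= a 0%N + k.+1%:R * a k - q (w k.+1 - w 0%N) (w k.+1 - w 0%N).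
Proof.
move=> alpha2.
have -> : w k.+1 - w 0%N = - k.+1%:R *: e k.
  by rewrite -(halpern_anchor k.+1 alpha2) GS opprD addrCA subrr addr0 scaleNr.
have a0 : w 0%N - p = (k%:R + 2) *: e k - F k + (w k - p).
  by rewrite -(halpern_anchor k alpha2) GE alpha2 divff ?pnatr_eq0// scale1r -addrA.
have := F_fix k; have [-> _ _ _ _] := expand k.
rewrite /a a0; move: (w k - p) => x.
rewrite !qE !(qC x) (qC (e k) (F k)) -(natr1 k.+1) -(natr1 k) => Fx.
rewrite -subr_ge0 [leRHS](_ : _ = (k%:R + 1) * (q (e k) (e k) + (2 * q (F k) x - q (F k) (F k)))).
  by apply: mulr_ge0; rewrite addr_ge0 ?subr_ge0.
by ring.
Qed.

Lemma halpern_dist_le k : alpha = 2 -> a k <= a 0%N.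
Proof.
move=> alpha2; elim: k => // k IH.
have k0 : 0 < k.+2%:R :> R by rewrite ltr0n.
rewrite -(ler_pM2l k0); apply: le_trans (halpern_step k alpha2) _.
have := ler_wpM2l (ler0n R k.+1) IH; have := q_ge0 (w k.+1 - w 0%N).
rewrite -(natr1 k.+1); lra.
Qed.

Lemma dist_bounded : exists C, forall k, a k <= C.
Proof.
move: alpha_ge2; rewrite le_eqVlt => /predU1P[alpha2|alpha2].
  by exists (a 0%N) => k; exact: halpern_dist_le.
by eexists => k; exact: dist_le.
Qed.

Lemma residual_null : (fun k => q (F k) (F k)) @ \oo --> (0 : R).
Proof.
move: alpha_ge2; rewrite le_eqVlt => /predU1P[alpha2|alpha2].
  (* The factor 4 comes from [|u - v|^2 <= 2 |u|^2 + 2 |v|^2], both squared distances being at most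
     [a 0]. *)
  apply: (@residual_cvg0 (4 * a 0%N)) => k.
  have -> : G k = (w 0%N - p) - (w k - p).
    by rewrite -(halpern_anchor k (esym alpha2)) opprB addrA subrK addrK.
  have := halpern_dist_le k (esym alpha2).
  have := q_ge0 ((w 0%N - p) + (w k - p)).
  by rewrite /a; move: (w 0%N - p) (w k - p) => u v; rewrite !qE (qC v u); lra.
have [+ _] := cvg_dist alpha2; move=> /cvgP/cvg_seq_bounded[M [_ /(_ (M + 1)) H]].
apply: (@residual_cvg0 (M + 1)) => k.
by apply: le_trans (H _ k I); [exact: ler_norm|rewrite ltrDl].
Qed.

End FixedPoint.

(* For [alpha = 2] the limit is the cluster point nearest to [w 0]; for
   [alpha > 2] the distance to every fixed point converges. *)
Theorem fast_KM_cvg (Fix : set W) : Fix !=set0 ->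
  (forall p k, Fix p -> q (F k) (F k) <= 2 * q (F k) (w k - p)) ->
  (forall f : nat -> nat, (forall n, (n <= f n)%N) -> exists p (h : nat -> nat),
    [/\ Fix p, forall n, (n <= h n)%N &
      (fun n => q (w (f (h n)) - p) (w (f (h n)) - p)) @ \oo --> (0 : R)]) ->
  exists2 p, Fix p & (fun k => q (w k - p) (w k - p)) @ \oo --> (0 : R).
Proof.
move=> [p0 Fp0] F_fix cluster.
have [alpha2|alpha2] := eqVneq alpha 2; last first.
  have {alpha2} : 2 < alpha by rewrite lt_neqAle eq_sym alpha2.
  move=> alpha2.
  have [p [h [Fp hn wp]]] := cluster id (fun n => leqnn n).
  exists p => //.
  have [_ /cvg_ex[l al]] := cvg_dist (fun k => F_fix p k Fp) alpha2.
  suff -> : 0 = l by [].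
  apply: cvg_unique wp _.
    exact: norm_hausdorff.
  exact: (cvg_comp _ _ (cvg_index hn) al).
pose u k := q (w k - w 0%N) (w k - w 0%N).
have uC k : 0 <= u k <= 4 * q (w 0%N - p0) (w 0%N - p0).
  rewrite /u q_ge0/=.
  have -> : w k - w 0%N = (w k - p0) - (w 0%N - p0) by rewrite opprB addrA subrK.
  have := halpern_dist_le (F_fix p0 ^~ Fp0) k alpha2.
  have := q_ge0 ((w 0%N - p0) + (w k - p0)).
  by move: (w 0%N - p0) (w k - p0) => x y; rewrite !qE (qC x y); lra.
have [l [f [fn ul lu]]] := liminf_subseq uC.
have [p [h [Fp hn wp]]] := cluster f fn.
have lE : l = q (w 0%N - p) (w 0%N - p).
  have -> : q (w 0%N - p) (w 0%N - p) = q (p - w 0%N) (p - w 0%N).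
    by rewrite -(opprB (w 0%N)) qNl qNr opprK.
  apply: (@cvg_unique _ _ (u \o f \o h @ \oo)); first exact: norm_hausdorff.
    exact: (cvg_comp _ _ (cvg_index hn) ul).
  apply: (@cvg_q_sqr (fun n => w (f (h n)) - w 0%N)).
  rewrite -[X in X @ _](_ : (fun n => q (w (f (h n)) - p) (w (f (h n)) - p)) = _)//.
  by apply/funext => n; rewrite opprB addrA subrK.
exists p => //.
rewrite (_ : (fun k => _) = fun k => k.+1%:R * q (w k - p) (w k - p) / k.+1%:R); last first.
  by apply/funext => k; rewrite mulrAC divff ?mul1r// pnatr_eq0.
(* [halpern_step] bounds the increments of [k.+1 * a k] by [l - u k.+1], eventually below any [eps]
   since [l] is the lower limit of [u]. *)
apply: (@cesaro_null _ _ (fun k => l - u k.+1)).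
- by move=> k; rewrite mulr_ge0 ?q_ge0 ?ler0n.
- move=> k; have := halpern_step (F_fix p ^~ Fp) k alpha2.
  by rewrite -lE /u; lra.
- move=> eps /lu [N _ uN]; exists N => // k /= Nk.
  by rewrite lerBlDr -lerBlDl uN//= leqW.
Qed.

End FastKrasnoselskiiMann.

(** * Finite-dimensional inner product spaces *)

Section Inner.
Context {R : realType} {E : euclideanType R}.
Implicit Types u v t : E.

Lemma innerC u v : '[u, v] = '[v, u].
Proof. by have /= := hermC (inner : {dot E for idfun}) u v; rewrite expr0 mul1r. Qed.

Lemma innerDl u v t : '[u + v, t] = '[u, t] + '[v, t].
Proof. exact: linearDl. Qed.

Lemma innerDr u v t : '[t, u + v] = '[t, u] + '[t, v].
Proof. exact: linearDr. Qed.

Lemma innerNl u v : '[- u, v] = - '[u, v].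
Proof. exact: linearNl. Qed.

Lemma innerNr u v : '[u, - v] = - '[u, v].
Proof. exact: linearNr. Qed.

Lemma innerZl c u v : '[c *: u, v] = c * '[u, v].
Proof. exact: linearZl_LR. Qed.

Lemma innerZr c u v : '[u, c *: v] = c * '[u, v].
Proof. exact: linearZr_LR. Qed.

Lemma inner_ge0 u : 0 <= '[u, u].
Proof.
have [->|u0] := eqVneq u 0; first by rewrite linear0l.
exact: ltW (neq0_dnorm_gt0 u u0).
Qed.

Lemma inner_norm u : '[u, u] = `|u| ^+ 2.
Proof. by rewrite normr_inner sqr_sqrtr ?inner_ge0. Qed.

Lemma cvg_inner (f g : nat -> E) u v : f @ \oo --> u -> g @ \oo --> v ->
  (fun n => '[f n, g n]) @ \oo --> '[u, v].
Proof.
move=> fu gv.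
have polar (x y : E) : '[x, y] = (`|x + y| * `|x + y| - `|x - y| * `|x - y|) / 4.
  by rewrite -!expr2 -!inner_norm !innerDl !innerDr !innerNl !innerNr (innerC y x); field.
rewrite polar (_ : (fun n => _) = fun n =>
    (`|f n + g n| * `|f n + g n| - `|f n - g n| * `|f n - g n|) / 4); last first.
  by apply/funext => n; exact: polar.
apply: cvgMr_tmp; apply: cvgB; apply: cvgM; apply: cvg_norm;
  by [exact: cvgD | exact: cvgB].
Qed.

End Inner.

Definition innerE := (@innerDl, @innerDr, @innerNl, @innerNr, @innerZl, @innerZr).

Import VectorInternalTheory.

(** * Compactness and bounded linear maps through coordinates *)

Section FiniteDimension.
Context {R : realType}.

Lemma rV_linear_bounded n (F : normedModType R) (L : {linear 'rV[R]_n -> F}) :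
  exists2 C, 0 < C & forall u, `|L u| <= C * `|u|.
Proof.
(* The leading 1 keeps the constant positive even for [L = 0]. *)
exists (1 + \sum_i `|L (delta_mx 0 i)|); first by rewrite ltr_pwDl// sumr_ge0.
move=> u; rewrite [in leLHS](row_sum_delta u) linear_sum.
apply: le_trans (ler_norm_sum _ _ _) _.
rewrite mulrDl mul1r mulr_suml ler_wpDl// ler_sum// => i _.
rewrite linearZ normrZ mulrC ler_wpM2l//.
rewrite [leRHS](_ : _ = \big[Num.max/0]_ij `|u ij.1 ij.2|); last by rewrite -mx_normrE.
by apply: (le_trans _ (le_bigmax _ _ (0, i))).
Qed.

Lemma rV_linear_norm_continuous n (F : normedModType R) (L : {linear 'rV[R]_n -> F}) :
  continuous (fun u => `|L u|).
Proof.
have [C C0 LC] := rV_linear_bounded L.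
have cL : continuous L.
  apply: bounded_linear_continuous; apply/linear_boundedP.
  exists C; split; first exact: num_real.
  by move=> r Cr x; rewrite (le_trans (LC x))// ler_wpM2r// ltW.
by move=> x; apply: continuous_comp (cL x) _; exact: norm_continuous.
Qed.

Context {E : normedVectType R}.

(** [|r2v u|] attains its minimum on the compact unit sphere, and injectivity of [r2v] makes it
    positive; in dimension 0 the sphere is empty and any constant works. *)
Lemma r2v_lower : exists2 m, 0 < m & forall u : 'rV[R]_(dim E), m * `|u| <= `|r2v u : E|.
Proof.
have [C C0 rC] := rV_linear_bounded (r2v : {linear 'rV[R]_(dim E) -> E}).
pose S := [set u : 'rV[R]_(dim E) | `|u| = 1].
have [S0|/nonemptyPn S0] := pselect (S !=set0); last first.
  exists 1 => // u; rewrite mul1r.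
  have [->|u0] := eqVneq u 0; first by rewrite normr0.
  exfalso; suff : S (`|u|^-1 *: u) by rewrite S0.
  by rewrite /S/= normrZ normfV normr_id mulVf ?normr_eq0.
have cS : compact S.
  apply: bounded_closed_compact.
    by exists 1; split => // x x1 u /= ->; exact: ltW.
  apply: (@preimage_closed _ _ (fun u : 'rV[R]_(dim E) => `|u|) [set 1]).
    by move=> x _; exact: norm_continuous.
  exact: closed_eq.
have rc : continuous (fun u : 'rV[R]_(dim E) => `|r2v u : E|).
  exact: (@rV_linear_norm_continuous _ E (r2v : {linear 'rV[R]_(dim E) -> E})).
have [u + uS] := compact_EVT_min S0 cS (continuous_subspaceT rc).
rewrite inE => Su; exists `|r2v u : E|.
  rewrite normr_gt0; apply/eqP => /(congr1 v2r); rewrite r2vK linear0 => u0.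
  by move: Su; rewrite /S/= u0 normr0 => /eqP; rewrite eq_sym oner_eq0.
move=> v; have [->|v0] := eqVneq v 0; first by rewrite normr0 mulr0.
have := uS (`|v|^-1 *: v); rewrite inE linearZ normrZ normfV normr_id => H.
rewrite -ler_pdivlMr ?normr_gt0// [leRHS]mulrC; apply: H.
by rewrite /S/= normrZ normfV normr_id mulVf ?normr_eq0.
Qed.

(** Bolzano-Weierstrass: by [r2v_lower] the coordinate vectors stay in a compact ball, and [f n]
    selects an index past [n] within [1 / n.+1] of a cluster point. *)
Lemma bounded_subseq (u : nat -> E) M : (forall n, `|u n| <= M) ->
  exists (p : E) (f : nat -> nat),
    (forall n, (n <= f n)%N) /\ (fun n => u (f n)) @ \oo --> p.
Proof.
move=> uM.
have [m m0 rm] := r2v_lower.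
have [C C0 rC] := rV_linear_bounded (r2v : {linear 'rV[R]_(dim E) -> E}).
have cB : compact [set v : 'rV[R]_(dim E) | `|v| <= M / m].
  apply: bounded_closed_compact.
    by exists (M / m); split; [exact: num_real|] => x Mx v /= /le_trans; apply; exact: ltW.
  apply: (@preimage_closed _ _ (fun u : 'rV[R]_(dim E) => `|u|) [set x | x <= M / m]).
    by move=> x _; exact: norm_continuous.
  exact: closed_le.
have vB n : `|v2r (u n)| <= M / m.
  by rewrite ler_pdivlMr// mulrC (le_trans (rm _))// v2rK.
have [//|v [_ vcl]] := cB ((v2r \o u) @ \oo) _; first by exists 0%N => // n _; exact: vB.
have sel n : exists k, (n <= k)%N /\ `|v - v2r (u k)| < n.+1%:R^-1.
  have [] := vcl [set v2r (u k) | k in [set k | (n <= k)%N]] (ball v n.+1%:R^-1).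
  - by exists n => // k nk; exists k.
  - by apply: nbhsx_ballx; rewrite invr_gt0.
  - by move=> _ [[k nk <-] /=]; rewrite -ball_normE => vk; exists k.
have [f fP] := choice sel.
exists (r2v v), f; split; first by move=> n; have [] := fP n.
apply/cvgrPdist_lt => eps eps0.
have /cvgr_lt/(_ _ (divr_gt0 eps0 C0)) := @cvg_harmonic R.
apply: filterS => n nC /=.
rewrite -[u _]v2rK -linearB (le_lt_trans (rC _))// mulrC -ltr_pdivlMr//.
exact: lt_trans (fP n).2 nC.
Qed.

Lemma linear_bounded (F : normedModType R) (L : {linear E -> F}) :
  exists2 C, 0 < C & forall u, `|L u| <= C * `|u|.
Proof.
have [m m0 rm] := r2v_lower.
have [C C0 LC] := rV_linear_bounded (L \o r2v : {linear 'rV[R]_(dim E) -> F}).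
exists (C / m); first exact: divr_gt0.
move=> u; rewrite -{1}(v2rK u); apply: le_trans (LC (v2r u)) _.
by rewrite -mulrA ler_wpM2l ?(ltW C0)// mulrC ler_pdivlMr// mulrC -{2}(v2rK u).
Qed.

Lemma cvg_linear (F : normedModType R) (L : {linear E -> F}) (u : nat -> E) p :
  u @ \oo --> p -> (fun n => L (u n)) @ \oo --> L p.
Proof.
move=> up; have [C C0 LC] := linear_bounded L.
apply/cvgrPdist_lt => eps eps0.
have /cvgrPdist_lt/(_ _ (divr_gt0 eps0 C0)) := up; apply: filterS => n un.
by rewrite -linearB (le_lt_trans (LC _))// mulrC -ltr_pdivlMr.
Qed.

End FiniteDimension.

Section Distance.
Context {R : realType} {E : normedModType R}.

Lemma cvg_sqr_dist (u : nat -> E) p (c : nat -> R) :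
  (forall n, `|u n - p| ^+ 2 <= c n) -> c @ \oo --> (0 : R) -> u @ \oo --> p.
Proof.
move=> uc c0; have := cvg0_sqr_le uc c0; move=> /cvgrPdist_lt H.
apply/cvgrPdist_lt => eps /H; apply: filterS => n.
by rewrite sub0r normrN normr_id distrC.
Qed.

End Distance.

Section Coercive.
Context {R : realType} {E : euclideanType R}.

(** Otherwise unit vectors with ['[v, S v]] tending to 0 would accumulate at a unit vector
    contradicting positivity. *)
Lemma posdef_coercive (S : {linear E -> E}) : posdef S ->
  exists2 m, 0 < m & forall v, m * `|v| ^+ 2 <= '[v, S v].
Proof.
move=> [_ Spos]; apply: contrapT => H.
have sel n : exists v : E, `|v| = 1 /\ '[v, S v] < n.+1%:R^-1.
  apply: contrapT => /forallNP Hn; apply: H; exists n.+1%:R^-1; first by rewrite invr_gt0.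
  move=> v; have [->|v0] := eqVneq v 0; first by rewrite normr0 expr0n mulr0 linear0l.
  rewrite leNgt; apply/negP => vn; apply: (Hn (`|v|^-1 *: v)); split.
    by rewrite normrZ normfV normr_id mulVf ?normr_eq0.
  rewrite linearZ/= !innerE mulrA -expr2 exprVn mulrC ltr_pdivrMr ?exprn_gt0 ?normr_gt0//.
have [v vP] := choice sel.
have v1 n : `|v n| <= 1 by rewrite (vP n).1.
have [p [f [fn vp]]] := bounded_subseq v1.
have p1 : `|p| = 1.
  apply: cvg_unique (cvg_norm vp) _; first exact: norm_hausdorff.
  rewrite (_ : (fun n => _) = cst 1); first exact: cvg_cst.
  by apply/funext => n /=; rewrite (vP _).1.
have p0 : p != 0 by rewrite -normr_eq0 p1 oner_eq0.
have := Spos p p0; apply/negP; rewrite -leNgt.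
have Sp := cvg_inner vp (cvg_linear (L := S) vp).
apply: (ler_cvg_to Sp (@cvg_harmonic R)).
apply: nearW => n /=; apply: le_trans (ltW (vP _).2) _.
by rewrite lef_pV2 ?posrE// ler_nat ltnS.
Qed.

End Coercive.

(** * Subdifferentials and optimality *)

Section Subdifferential.
Context {R : realType} {E : euclideanType R}.
Implicit Types f : E -> \bar R.

(** If [f u] were [+oo], the subgradient inequality tested at a point of the domain would make [f]
    infinite there. *)
Lemma subdiff_fin_num f u phi : proper_fun f -> subdiff f u phi -> f u \is a fin_num.
Proof.
move=> [fNoo [v fv]] fu; rewrite fin_real// fNoo /=.
have := fu v; case: (f u) => [r| |]//=; first by rewrite ltry.
by rewrite addye// => /le_lt_trans/(_ fv); rewrite ltxx.
Qed.

Lemma subdiff_real f u phi : proper_fun f -> subdiff f u phi ->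
  exists a, f u = a%:E.
Proof.
by move=> fp fu; exists (fine (f u)); rewrite fineK// (subdiff_fin_num fp fu).
Qed.

Lemma opnorm_sqr (S : E -> E) v : possemidef S -> opnorm S v ^+ 2 = '[v, S v].
Proof. by move=> [_ S0]; rewrite /opnorm sqr_sqrtr. Qed.

Lemma subdiff_modulus f Sigma u v phi psi : proper_fun f -> convexity_modulus f Sigma ->
  subdiff f u phi -> subdiff f v psi ->
  '[u - v, Sigma (u - v)] <= '[phi - psi, u - v].
Proof.
move=> fp [Sp Sf] fu fv; rewrite -opnorm_sqr//; apply: (Sf _ _ _ _ _ _ fu fv).2.
  by rewrite /dom/= ltey_eq (subdiff_fin_num fp fu).
by rewrite /dom/= ltey_eq (subdiff_fin_num fp fv).
Qed.

(** Subgradients are only asked to converge when paired with [v - u n], which is what seminorm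
    estimates supply in [prox_image_closed]. *)
Lemma subdiff_closed f (u phi : nat -> E) p psi :
  proper_fun f -> lower_semicontinuous f -> u @ \oo --> p ->
  (forall n, subdiff f (u n) (phi n)) ->
  (forall v, (fun n => '[phi n, v - u n]) @ \oo --> '[psi, v - p]) ->
  subdiff f p psi.
Proof.
move=> fp flsc up fu phiv v.
have := fp.1 v; case fv : (f v) => [a| |]// _; last by rewrite leey.
rewrite leNgt; apply/negP => H.
(* [eps] is half the gap in the violated inequality, or 1 when [f p = +oo]. *)
have [eps eps0 Heps] : exists2 eps : R, 0 < eps & ((a - '[psi, v - p] + eps)%:E < f p)%E.
  move: H; have := fp.1 p; case: (f p) => [b| |]//.
    rewrite -EFinD lte_fin => _ H; exists ((b + '[psi, v - p] - a) / 2); first by lra.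
    by rewrite lte_fin; lra.
  by move=> _ _; exists 1; rewrite ?ltry.
have [V pV fV] := flsc _ _ Heps.
have : \forall n \near \oo, False.
  have N1 : \forall n \near \oo, V (u n) by exact: up.
  have N2 : \forall n \near \oo, '[psi, v - p] - eps < '[phi n, v - u n].
    by apply: (cvgr_gt _ (phiv v)); rewrite ltrBlDr ltrDl.
  near=> n.
  have /fV : V (u n) by near: n.
  have : '[psi, v - p] - eps < '[phi n, v - u n] by near: n.
  have := fu n v; rewrite fv; have := subdiff_fin_num fp (fu n).
  case: (f (u n)) => [b| |]// _.
  by rewrite -EFinD lee_fin lte_fin; lra.
by case=> N _ /(_ N (leqnn N)).
Unshelve. all: by end_near. Qed.

(* Fermat's rule: comparing [u] with [u + t (v - u)] and letting t go to 0. *)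
Lemma argmin_subdiff f (Q : E -> R) (K : E -> R) g u :
  proper_fun f -> convex_fun f ->
  (forall h t, Q (u + t *: h) = Q u + t * '[g, h] + t ^+ 2 * K h) ->
  argmin (fun v => f v + (Q v)%:E)%E u -> subdiff f u (- g).
Proof.
move=> fp fc Qu umin v.
have fufin : f u \is a fin_num.
  have [fNoo [v0 fv0]] := fp; rewrite fin_real// fNoo /=.
  have := umin v0; move: fv0; rewrite /dom/= -/(dom f); have := fNoo v0.
  case: (f v0) => // r _ _; case: (f u) => [s| |]; rewrite ?ltry//.
have := fp.1 v; case fv : (f v) => [a| |]// _; last by rewrite leey.
have [b fu] : exists b, f u = b%:E by exists (fine (f u)); rewrite fineK.
rewrite fu -EFinD lee_fin innerNl.
have H t : 0 < t <= 1 -> b - a - '[g, v - u] <= t * K (v - u).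
  move=> /andP[t0 t1].
  have := umin (u + t *: (v - u)).
  have := fc v u t; rewrite (ltW t0) t1 => /(_ isT).
  have -> : t *: v + (1 - t) *: u = u + t *: (v - u).
    by rewrite scalerBl scale1r scalerBr addrCA.
  rewrite Qu fu fv -!EFinM -!EFinD.
  case: (f _) => [c| |]//; rewrite ?lee_fin// => H1 H2.
  rewrite -(ler_pM2l t0).
  have : b <= t * a + (1 - t) * b + t * '[g, v - u] + t ^+ 2 * K (v - u) by lra.
  by lra.
suff : b - a - '[g, v - u] <= 0 by lra.
have K0 : (fun n => n.+1%:R^-1 * K (v - u)) @ \oo --> (0 : R).
  by rewrite -[0](mul0r (K (v - u))); apply: cvgMr_tmp; exact: cvg_harmonic.
apply: (cvgr_to_ge K0); apply: nearW => n; apply: H.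
by rewrite invr_gt0 ltr0n/= invf_le1 ?ltr0n// ler1n.
Qed.

End Subdifferential.

Section Optimality.
Context {R : realType} {X Y Z : euclideanType R}.
Variables (f1 : Y -> \bar R) (f2 : Z -> \bar R).
Variables (B1 : {linear Y -> X}) (B2 : {linear Z -> X}) (c : X).
Variables (B1s : {linear X -> Y}) (B2s : {linear X -> Z}).
Hypotheses (f1p : proper_fun f1) (f2p : proper_fun f2).
Hypotheses (B1_adj : adjoint B1 B1s) (B2_adj : adjoint B2 B2s).

(** In the sum of the two subgradient inequalities, the linear terms pair [x] with the difference of
    two feasible constraint values, which is 0. *)
Lemma KKT_primal_solution y z x : KKT f1 f2 B1 B2 c B1s B2s y z x ->
  primal_solution f1 f2 B1 B2 c y z.
Proof.
move=> [sy sz /eqP]; rewrite subr_eq0 => /eqP Bc; split => // y' z' Bc'.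
have := sy y'; have := sz z'.
have [a ->] := subdiff_real f1p sy.
have [b ->] := subdiff_real f2p sz.
have := f1p.1 y'; have := f2p.1 z'.
case: (f1 y') => [a'| |]//; case: (f2 z') => [b'| |]// _ _; rewrite ?leey//.
rewrite -!EFinD !lee_fin.
rewrite !innerNl -(innerC (y' - y)) -(innerC (z' - z)) -B1_adj -B2_adj !linearB/= !innerE.
have : '[B1 y' + B2 z', x] = '[B1 y + B2 z, x] by rewrite Bc Bc'.
by rewrite !innerE; lra.
Qed.

(** The primal value [a + b] bounds every dual value by Fenchel-Young at [(y, z)], and the two
    subgradient inclusions show that [x] reaches it. *)
Lemma KKT_dual_solution y z x : KKT f1 f2 B1 B2 c B1s B2s y z x ->
  dual_solution f1 f2 c B1s B2s x.
Proof.
move=> [sy sz /eqP]; rewrite subr_eq0 => /eqP Bc x'.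
have [a fy] := subdiff_real f1p sy.
have [b fz] := subdiff_real f2p sz.
have ge1 s : (('[s, y] - a)%:E <= conjugate f1 s)%E.
  by apply: ereal_sup_ubound; exists y => //; rewrite fy.
have ge2 s : (('[s, z] - b)%:E <= conjugate f2 s)%E.
  by apply: ereal_sup_ubound; exists z => //; rewrite fz.
have le1 : (conjugate f1 (- B1s x)%R <= ('[(- B1s x)%R, y] - a)%:E)%E.
  apply: ge_ereal_sup => _ [v _ <-]; have := sy v; rewrite fy.
  have := f1p.1 v; case: (f1 v) => [r| |]// _; last by rewrite /= leNye.
  by rewrite -EFinD !lee_fin innerDr innerNr; lra.
have le2 : (conjugate f2 (- B2s x)%R <= ('[(- B2s x)%R, z] - b)%:E)%E.
  apply: ge_ereal_sup => _ [v _ <-]; have := sz v; rewrite fz.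
  have := f2p.1 v; case: (f2 v) => [r| |]// _; last by rewrite /= leNye.
  by rewrite -EFinD !lee_fin innerDr innerNr; lra.
rewrite /dual_objective.
have inner_c t : '[- B1s t, y] + '[- B2s t, z] = - '[c, t].
  by rewrite !innerNl (innerC _ y) (innerC _ z) -B1_adj -B2_adj -Bc innerDl opprD.
apply: (@le_trans _ _ (a + b)%:E).
  move: (ge1 (- B1s x')) (ge2 (- B2s x')); have := inner_c x'.
  case: (conjugate f1 _) => [r1| |]//; case: (conjugate f2 _) => [r2| |]//; rewrite /= ?leNye//.
  by rewrite !lee_fin; lra.
move: (ge1 (- B1s x)) (ge2 (- B2s x)) le1 le2; have := inner_c x.
case: (conjugate f1 _) => [r1| |]//; case: (conjugate f2 _) => [r2| |]//.
by rewrite -!EFinN -!EFinD !lee_fin; lra.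
Qed.

End Optimality.

(** * The degenerate proximal point map *)

(** Reduces vector identities to scalar ones, where [ring] and [lra] apply. *)
Lemma inner_inj {R : realType} {E : euclideanType R} (u v : E) :
  (forall h, '[u, h] = '[v, h]) -> u = v.
Proof.
move=> uv; apply/eqP; rewrite -subr_eq0 -normr_eq0 -sqrf_eq0 -inner_norm.
by rewrite innerDl innerNl uv subrr.
Qed.

Lemma adjoint_sym {R : realType} {E F : euclideanType R} (A : E -> F) (As : F -> E) :
  adjoint A As -> adjoint As A.
Proof. by move=> AAs u v; rewrite innerC -AAs innerC. Qed.

Section ProximalStep.
Context {R : realType} {X E : euclideanType R}.
Variables (f : E -> \bar R) (A : {linear E -> X}) (As : {linear X -> E}).
Variables (T : {linear E -> E}) (sigma : R).
Hypotheses (fp : proper_fun f) (fc : convex_fun f).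
Hypotheses (A_adj : adjoint A As) (T_psd : possemidef T).

Lemma prox_subdiff (x e : X) (v u : E) C :
  argmin (fun t => f t + ('[x, A t + e] + sigma / 2 * `|A t + e| ^+ 2
                          + 2^-1 * opnorm T (t - v) ^+ 2 + C)%:E)%E u ->
  subdiff f u (T (v - u) - As (x + sigma *: (A u + e))).
Proof.
move=> umin.
have -> : T (v - u) - As (x + sigma *: (A u + e)) = - (As (x + sigma *: (A u + e)) + T (u - v)).
  by rewrite opprD addrC; congr (_ + _); rewrite -linearN opprB.
apply: (argmin_subdiff (K := fun h => sigma / 2 * '[A h, A h] + 2^-1 * '[h, T h])
  fp fc _ umin).
move=> h t.
have -> : A (u + t *: h) + e = A u + e + t *: A h by rewrite linearD linearZ addrAC.
have -> : u + t *: h - v = u - v + t *: h by rewrite addrAC.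
have -> : '[As (x + sigma *: (A u + e)) + T (u - v), h]
    = '[x + sigma *: (A u + e), A h] + '[u - v, T h].
  by rewrite [LHS]innerDl (adjoint_sym A_adj) T_psd.1.
move: (A u + e) (u - v) => y d.
rewrite !opnorm_sqr// -!inner_norm (linearD T) (linearZ_LR T)/= !innerE.
rewrite (innerC (A h) y) -(T_psd.1 h d) (innerC _ d).
by field.
Qed.

End ProximalStep.

Section DegenerateProximalPoint.
Context {R : realType} {X Y Z : euclideanType R}.
Variables (f1 : Y -> \bar R) (f2 : Z -> \bar R).
Variables (B1 : {linear Y -> X}) (B2 : {linear Z -> X}) (c : X).
Variables (B1s : {linear X -> Y}) (B2s : {linear X -> Z}).
Variables (T1 Sigma1 : {linear Y -> Y}) (T2 Sigma2 : {linear Z -> Z}).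
Variable sigma : R.
Hypotheses (f1_pcc : proper_closed_convex f1) (f2_pcc : proper_closed_convex f2).
Hypotheses (B1_adj : adjoint B1 B1s) (B2_adj : adjoint B2 B2s).
Hypotheses (T1_psd : possemidef T1) (T2_psd : possemidef T2).
Hypotheses (Sigma1_f1 : convexity_modulus f1 Sigma1)
           (Sigma2_f2 : convexity_modulus f2 Sigma2).
Hypothesis sigma_gt0 : 0 < sigma.

Let W := (Y * Z * X)%type.
Implicit Types w v : W.

(** The degenerate metric sees the multiplier only through this combination; factoring it out makes
    semidefiniteness of [form] visible. *)
Definition xi w : X := w.2 + sigma *: B1 w.1.1.

(* The bilinear form of the degenerate proximal term
   [[sigma B1s B1 + T1, 0, B1s], [0, T2, 0], [B1, 0, 1 / sigma]]. *)
Definition form w v : R :=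
  '[w.1.1, T1 v.1.1] + '[w.1.2, T2 v.1.2] + sigma^-1 * '[xi w, xi v].

(** Row by row, [M (w - wb)] belongs to the KKT operator at [wb], with [M] the metric of [form]. As
    a relation, it can be verified on the iterates without constructing a resolvent. *)
Definition prox_image w wb : Prop :=
  [/\ subdiff f1 wb.1.1 (T1 (w - wb).1.1 + B1s (xi (w - wb)) - B1s wb.2),
      subdiff f2 wb.1.2 (T2 (w - wb).1.2 - B2s wb.2)
    & xi (w - wb) = sigma *: (c - B1 wb.1.1 - B2 wb.1.2)].

Lemma xiD w v : xi (w + v) = xi w + xi v.
Proof. by rewrite /xi/= linearD scalerDr addrACA. Qed.

Lemma xiZ a w : xi (a *: w) = a *: xi w.
Proof. by rewrite /xi/= linearZ/= scalerDr !scalerA mulrC. Qed.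

Lemma xiB w v : xi (w - v) = xi w - xi v.
Proof. by rewrite xiD -scaleN1r xiZ scaleN1r. Qed.

Lemma formC w v : form w v = form v w.
Proof.
rewrite /form (innerC (xi w)) -(T1_psd.1 w.1.1) -(T2_psd.1 w.1.2).
by rewrite (innerC (T1 _)) (innerC (T2 _)).
Qed.

Lemma formDl w v u : form (w + v) u = form w u + form v u.
Proof. by rewrite /form xiD/= !innerE; ring. Qed.

Lemma formZl a w v : form (a *: w) v = a * form w v.
Proof. by rewrite /form xiZ/= !innerE; ring. Qed.

Lemma form_ge0 w : 0 <= form w w.
Proof.
by rewrite /form !addr_ge0 ?T1_psd.2 ?T2_psd.2// mulr_ge0 ?inner_ge0// invr_ge0 ltW.
Qed.

Lemma xi_form w : `|xi w| ^+ 2 <= sigma * form w w.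
Proof.
rewrite /form !mulrDr mulrA divff ?gt_eqF// mul1r inner_norm lerDr.
by rewrite addr_ge0// mulr_ge0 ?T1_psd.2 ?T2_psd.2// ltW.
Qed.

Lemma KKT_prox_image y z x : KKT f1 f2 B1 B2 c B1s B2s y z x ->
  prox_image (y, z, x) (y, z, x).
Proof.
move=> [sy sz Bc]; rewrite /prox_image/= !subrr !linear0 !add0r.
have -> : xi 0 = 0 by rewrite -(scale0r 0) xiZ scale0r.
split=> //; first by rewrite linear0 add0r.
by rewrite -addrA -opprD -opprB Bc oppr0 scaler0.
Qed.

(** * A priori bounds on the difference of two proximal images *)

Section Estimates.
Variables (ay dy : Y) (az dz : Z) (dx zeta : X).
Hypothesis diff_z : '[dz, Sigma2 dz] <= '[az - dz, T2 dz] - '[dx, B2 dz].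
Hypothesis diff_x : dx = zeta + sigma *: B2 dz.
Hypothesis diff_y : '[dy, Sigma1 dy] <=
  '[ay - dy, T1 dy] + '[zeta - 2 *: dx - sigma *: B1 dy, B1 dy].

Let D := '[ay, T1 ay] + '[az, T2 az] + sigma^-1 * `|zeta| ^+ 2.

Let D_ge0 : 0 <= D.
Proof. by rewrite !addr_ge0 ?T1_psd.2 ?T2_psd.2// mulr_ge0// invr_ge0 ltW. Qed.

Let zeta_le : `|zeta| ^+ 2 <= sigma * D.
Proof.
rewrite /D !mulrDr mulrA divff ?gt_eqF// mul1r lerDr.
by rewrite addr_ge0// mulr_ge0 ?T1_psd.2 ?T2_psd.2// ltW.
Qed.

Let young (t u : X) (a : R) : 0 < a -> 2 * '[t, u] <= a * `|t| ^+ 2 + a^-1 * `|u| ^+ 2.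
Proof.
move=> a0; have := inner_ge0 (a *: t - u); rewrite !innerE !inner_norm (innerC u t) => H.
rewrite -(ler_pM2l a0).
have -> : a * (a * `|t| ^+ 2 + a^-1 * `|u| ^+ 2) = a ^+ 2 * `|t| ^+ 2 + `|u| ^+ 2.
  by field; rewrite gt_eqF.
lra.
Qed.

Let young_psd (E : euclideanType R) (T : {linear E -> E}) (t u : E) : possemidef T ->
  2 * '[t, T u] <= '[t, T t] + '[u, T u].
Proof.
move=> [Tsym T0]; have := T0 (t - u).
rewrite (linearB T) !innerE -(Tsym u t) (innerC (T u)); lra.
Qed.

(** Substituting [diff_x] produces [- sigma * |B2 dz|^2]; Young's inequality with weight [1 / sigma]
    on the cross term with [zeta] consumes only half of it. *)
Let energy_z : '[dz, Sigma2 dz] + '[dz, T2 dz] / 2 + sigma * `|B2 dz| ^+ 2 / 2 <= D / 2.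
Proof.
have := diff_z; rewrite diff_x /D.
have := young_psd az dz T2_psd.
have := young (- zeta) (B2 dz) (a := sigma^-1).
rewrite invr_gt0 => /(_ sigma_gt0); rewrite invrK normrN !innerE (inner_norm (B2 dz)).
have := T1_psd.2 ay; lra.
Qed.

Let norm_B2 : sigma * `|B2 dz| ^+ 2 <= D.
Proof.
have := energy_z; have := T2_psd.2 dz; have := Sigma2_f2.1.2 dz; lra.
Qed.

Let norm_x : `|dx| ^+ 2 <= 4 * sigma * D.
Proof.
have := young zeta (sigma *: B2 dz) (a := 1) ltr01; rewrite invr1 !mul1r.
rewrite diff_x -!inner_norm !innerE (innerC (B2 dz) zeta) => H.
have := zeta_le; rewrite -inner_norm.
have := ler_wpM2l (ltW sigma_gt0) norm_B2; rewrite -inner_norm.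
lra.
Qed.

(** The Young weights [2 / sigma] and [4 / sigma] charge [sigma / 4 * |B1 dy|^2] to each cross term,
    half of what is available. The data cost [1/2 + 1 + 16] times [D], the 16 coming from
    [norm_x]. *)
Let energy_y : '[dy, Sigma1 dy] + '[dy, T1 dy] / 2 + sigma * `|B1 dy| ^+ 2 / 2 <= 18 * D.
Proof.
have := diff_y; have := young_psd ay dy T1_psd.
have s2 : 0 < 2 / sigma by rewrite divr_gt0.
have s4 : 0 < 4 / sigma by rewrite divr_gt0.
have := young zeta (B1 dy) s2; have := young (- dx) (B1 dy) s4.
rewrite normrN !invf_div !innerE.
have : 2 / sigma * `|zeta| ^+ 2 <= 2 * D.
  by rewrite mulrAC ler_pdivrMr// -mulrA ler_wpM2l// mulrC.
have : 4 / sigma * `|dx| ^+ 2 <= 16 * D.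
  by rewrite mulrAC ler_pdivrMr//; have := norm_x; lra.
have : '[ay, T1 ay] <= D.
  rewrite /D -addrA lerDl addr_ge0 ?T2_psd.2// mulr_ge0// invr_ge0 ltW//.
rewrite (inner_norm (B1 dy)); have := D_ge0; lra.
Qed.

(** By coercivity, [energy_y] suffices for [dy]: it gives at most [18 D] for [Sigma1], [36 D] for
    [T1] and [36 D / sigma] for [B1], hence 54. The z-block needs less. *)
Lemma difference_estimates m1 m2 : 0 < m1 -> 0 < m2 ->
  (forall y, m1 * `|y| ^+ 2 <= '[y, Sigma1 y + B1s (B1 y) + T1 y]) ->
  (forall z, m2 * `|z| ^+ 2 <= '[z, Sigma2 z + B2s (B2 z) + T2 z]) ->
  [/\ `|dy| ^+ 2 <= 54 * (1 + sigma^-1) / m1 * D,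
      `|dz| ^+ 2 <= 54 * (1 + sigma^-1) / m2 * D & `|dx| ^+ 2 <= 4 * sigma * D].
Proof.
move=> m1_gt0 m2_gt0 coer1 coer2.
have Ds : 0 <= sigma^-1 * D by rewrite mulr_ge0// invr_ge0 ltW.
split => //; rewrite mulrAC ler_pdivlMr// mulrC.
  apply: le_trans (coer1 dy) _; rewrite !innerDr -B1_adj inner_norm.
  have : `|B1 dy| ^+ 2 <= 36 * (sigma^-1 * D).
    rewrite mulrCA ler_pdivlMl//.
    have := energy_y; have := T1_psd.2 dy; have := Sigma1_f1.1.2 dy; lra.
  have := energy_y; have := Sigma1_f1.1.2 dy.
  have : 0 <= sigma * `|B1 dy| ^+ 2 by rewrite mulr_ge0// ltW.
  have := T1_psd.2 dy; lra.
apply: le_trans (coer2 dz) _; rewrite !innerDr -B2_adj inner_norm.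
have : `|B2 dz| ^+ 2 <= sigma^-1 * D by rewrite ler_pdivlMl.
have := energy_z; have := Sigma2_f2.1.2 dz.
have : 0 <= sigma * `|B2 dz| ^+ 2 by rewrite mulr_ge0// ltW.
have := T2_psd.2 dz; lra.
Qed.

End Estimates.

Section Difference.
Variables (w wb v vb : W).
Hypotheses (wP : prox_image w wb) (vP : prox_image v vb).
Let dy := wb.1.1 - vb.1.1.
Let dz := wb.1.2 - vb.1.2.
Let dx := wb.2 - vb.2.
Let ay := w.1.1 - v.1.1.
Let az := w.1.2 - v.1.2.
Let zeta := xi (w - v).

Let diff_z : '[dz, Sigma2 dz] <= '[az - dz, T2 dz] - '[dx, B2 dz].
Proof.
have [_ wz _] := wP; have [_ vz _] := vP; have [f2p _ _] := f2_pcc.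
apply: le_trans (subdiff_modulus f2p Sigma2_f2 wz vz) _.
rewrite [X in '[X, _]](_ : _ = T2 (az - dz) - B2s dx).
  rewrite -/dz; move: (az - dz) dz dx => a d x.
  by rewrite [in leLHS]innerDl [in leLHS]innerNl T2_psd.1 (adjoint_sym B2_adj).
apply: inner_inj => h.
by rewrite /az /dz /dx/= !(linearB T2, linearB B2s) !innerE; ring.
Qed.

(** In the third row the terms in [B1] of the image cancel, leaving the new multiplier explicit in
    [xi w] and the z-block. *)
Let diff_x : dx = zeta + sigma *: B2 dz.
Proof.
have [_ _ wx] := wP; have [_ _ vx] := vP.
have wE : wb.2 = xi w + sigma *: (B2 wb.1.2 - c).
  apply: inner_inj => h; have := congr1 (inner ^~ h) wx.
  by rewrite xiB {2}/xi !innerE; lra.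
have vE : vb.2 = xi v + sigma *: (B2 vb.1.2 - c).
  apply: inner_inj => h; have := congr1 (inner ^~ h) vx.
  by rewrite xiB {2}/xi !innerE; lra.
by apply: inner_inj => h; rewrite /dx wE vE /zeta /dz xiB (linearB B2) !innerE; ring.
Qed.

Let diff_y : '[dy, Sigma1 dy] <=
  '[ay - dy, T1 dy] + '[zeta - 2 *: dx - sigma *: B1 dy, B1 dy].
Proof.
have [wy _ _] := wP; have [vy _ _] := vP; have [f1p _ _] := f1_pcc.
apply: le_trans (subdiff_modulus f1p Sigma1_f1 wy vy) _.
rewrite [X in '[X, _]](_ : _ = T1 (ay - dy) + B1s (zeta - 2 *: dx - sigma *: B1 dy)).
  rewrite -/dy; move: (ay - dy) dy (_ - _ *: B1 _) => a d x.
  by rewrite [in leLHS]innerDl T1_psd.1 (adjoint_sym B1_adj).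
rewrite (_ : zeta - 2 *: dx - sigma *: B1 dy = xi (w - wb) - xi (v - vb) - dx); last first.
  by apply: inner_inj => h; rewrite /zeta /dx /dy /xi/= !(linearB B1) !innerE; ring.
apply: inner_inj => h.
by rewrite /ay /dy /dx/= !(linearB T1, linearB B1s) !innerE; ring.
Qed.

(** Once [zeta] is eliminated by [diff_x], the form is exactly the sum of the right-hand sides of
    [diff_y] and [diff_z], each bounded below by a nonnegative [Sigma] term. *)
Lemma prox_image_monotone : 0 <= form ((w - wb) - (v - vb)) (wb - vb).
Proof.
have -> : form ((w - wb) - (v - vb)) (wb - vb) = '[ay - dy, T1 dy] + '[az - dz, T2 dz]
    + sigma^-1 * '[zeta - dx - sigma *: B1 dy, dx + sigma *: B1 dy].
  have ey : (w - wb - (v - vb)).1.1 = ay - dy.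
    by apply: inner_inj => h; rewrite /ay /dy/= !innerE; ring.
  have ez : (w - wb - (v - vb)).1.2 = az - dz.
    by apply: inner_inj => h; rewrite /az /dz/= !innerE; ring.
  have ex : xi (w - wb - (v - vb)) = zeta - dx - sigma *: B1 dy.
    by apply: inner_inj => h; rewrite /zeta /dx /dy /xi/= !(linearD B1, linearN B1) !innerE; ring.
  by rewrite /form ey ez ex.
have := diff_y; have := diff_z; have -> : zeta = dx - sigma *: B2 dz by rewrite diff_x addrK.
have := Sigma1_f1.1.2 dy; have := Sigma2_f2.1.2 dz.
move: ay az dy dz dx => a1 a2 d1 d2 d.
move: (a1 - d1) (a2 - d2) => e1 e2.
have -> : sigma^-1 * '[d - sigma *: B2 d2 - d - sigma *: B1 d1, d + sigma *: B1 d1]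
    = - '[B2 d2 + B1 d1, d + sigma *: B1 d1].
  by rewrite !innerE; field; rewrite gt_eqF.
rewrite !innerE (innerC d (B1 d1)) (innerC d (B2 d2)).
lra.
Qed.

Lemma prox_image_bound m1 m2 : 0 < m1 -> 0 < m2 ->
  (forall y, m1 * `|y| ^+ 2 <= '[y, Sigma1 y + B1s (B1 y) + T1 y]) ->
  (forall z, m2 * `|z| ^+ 2 <= '[z, Sigma2 z + B2s (B2 z) + T2 z]) ->
  let D := form (w - v) (w - v) in
  [/\ `|dy| ^+ 2 <= 54 * (1 + sigma^-1) / m1 * D,
      `|dz| ^+ 2 <= 54 * (1 + sigma^-1) / m2 * D & `|dx| ^+ 2 <= 4 * sigma * D].
Proof.
move=> m1_gt0 m2_gt0 coer1 coer2 D.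
have -> : D = '[ay, T1 ay] + '[az, T2 az] + sigma^-1 * `|zeta| ^+ 2.
  by rewrite /D /form inner_norm.
exact: difference_estimates diff_z diff_x diff_y _ _ m1_gt0 m2_gt0 coer1 coer2.
Qed.

End Difference.

Lemma prox_image_lipschitz :
  posdef (fun y => Sigma1 y + B1s (B1 y) + T1 y) ->
  posdef (fun z => Sigma2 z + B2s (B2 z) + T2 z) ->
  exists2 L, 0 <= L & forall w wb v vb, prox_image w wb -> prox_image v vb ->
    [/\ `|wb.1.1 - vb.1.1| ^+ 2 <= L * form (w - v) (w - v),
        `|wb.1.2 - vb.1.2| ^+ 2 <= L * form (w - v) (w - v)
      & `|wb.2 - vb.2| ^+ 2 <= L * form (w - v) (w - v)].
Proof.
move=> pd1 pd2.
have [m1 m1_gt0 coer1] := posdef_coercive (S := Sigma1 \+ (B1s \o B1) \+ T1) pd1.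
have [m2 m2_gt0 coer2] := posdef_coercive (S := Sigma2 \+ (B2s \o B2) \+ T2) pd2.
have L_ge0 m : 0 < m -> 0 <= 54 * (1 + sigma^-1) / m.
  by move=> m0; rewrite !mulr_ge0// ?invr_ge0 ?ltW// addr_gt0// invr_gt0.
have L3_ge0 : 0 <= 4 * sigma by rewrite mulr_ge0// ltW.
have [L1_ge0 L2_ge0] := (L_ge0 _ m1_gt0, L_ge0 _ m2_gt0).
exists (54 * (1 + sigma^-1) / m1 + 54 * (1 + sigma^-1) / m2 + 4 * sigma).
  by rewrite !addr_ge0.
move=> w wb v vb wP vP.
have [Hy Hz Hx] := prox_image_bound wP vP m1_gt0 m2_gt0 coer1 coer2.
have D_ge0 := form_ge0 (w - v).
split; [apply: le_trans Hy _|apply: le_trans Hz _|apply: le_trans Hx _];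
  rewrite ler_wpM2r//; lra.
Qed.

(** The residuals vanish only in the seminorm, which still controls [xi] of them in norm and, by
    Cauchy-Schwarz for [T1] and [T2], the remaining pairings. *)
Lemma prox_image_closed (w wb : nat -> W) y z x :
  (forall n, prox_image (w n) (wb n)) ->
  (fun n => (wb n).1.1) @ \oo --> y -> (fun n => (wb n).1.2) @ \oo --> z ->
  (fun n => (wb n).2) @ \oo --> x ->
  (fun n => form (w n - wb n) (w n - wb n)) @ \oo --> (0 : R) ->
  KKT f1 f2 B1 B2 c B1s B2s y z x.
Proof.
move=> wP yb zb xb r0.
have [f1p f1lsc _] := f1_pcc; have [f2p f2lsc _] := f2_pcc.
have dominated (a : nat -> R) : (forall n, 0 <= a n <= form (w n - wb n) (w n - wb n)) ->
    a @ \oo --> (0 : R).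
  by move=> aD; apply: (squeeze_cvgr _ (cvg_cst 0) r0); exact: nearW.
have psd_null (E : euclideanType R) (T : {linear E -> E}) (r d : nat -> E) (d0 : E) :
    possemidef T -> (fun n => '[r n, T (r n)]) @ \oo --> (0 : R) -> d @ \oo --> d0 ->
    (fun n => '[T (r n), d n]) @ \oo --> (0 : R).
  move=> [Tsym T0] rT dd; pose q (u v : E) := '[u, T v].
  have qC (u v : E) : q u v = q v u by rewrite /q -(Tsym u v) innerC.
  have qDl (u v t : E) : q (u + v) t = q u t + q v t by rewrite /q innerDl.
  have qZl a (u v : E) : q (a *: u) v = a * q u v by rewrite /q innerZl.
  apply: (@cvg0_sqr_le _ _ (fun n => '[r n, T (r n)] * '[d n, T (d n)])).
    by move=> n; rewrite Tsym; exact: (q_cauchy_schwarz qC qDl qZl T0).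
  rewrite -[0](mul0r '[d0, T d0]); apply: cvgM => //.
  by apply: cvg_inner => //; exact: cvg_linear.
have xir : (fun n => xi (w n - wb n)) @ \oo --> (0 : X).
  apply/norm_cvg0P; apply: (@cvg0_sqr_le _ _ (fun n => sigma * form (w n - wb n) (w n - wb n))).
    by move=> n; exact: xi_form.
  by rewrite -[0](mulr0 sigma); exact: cvgMl_tmp.
have rT1 : (fun n => '[(w n - wb n).1.1, T1 (w n - wb n).1.1]) @ \oo --> (0 : R).
  apply: dominated => n; rewrite T1_psd.2/= /form -addrA lerDl addr_ge0 ?T2_psd.2//.
  by rewrite mulr_ge0 ?inner_ge0// invr_ge0 ltW.
have rT2 : (fun n => '[(w n - wb n).1.2, T2 (w n - wb n).1.2]) @ \oo --> (0 : R).
  apply: dominated => n; rewrite T2_psd.2/= /form addrAC lerDr addr_ge0 ?T1_psd.2//.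
  by rewrite mulr_ge0 ?inner_ge0// invr_ge0 ltW.
split.
- have sub n : subdiff f1 (wb n).1.1
      (T1 (w n - wb n).1.1 + B1s (xi (w n - wb n)) - B1s (wb n).2) by have [] := wP n.
  apply: (subdiff_closed f1p f1lsc yb sub) => t.
  have ty : (fun n => t - (wb n).1.1) @ \oo --> t - y by apply: cvgB => //; exact: cvg_cst.
  have -> : '[- B1s x, t - y] = 0 + '[0 : X, B1 (t - y)] - '[x, B1 (t - y)].
    by rewrite linear0l !add0r innerNl (adjoint_sym B1_adj).
  rewrite (_ : (fun n => _) = fun n => '[T1 (w n - wb n).1.1, t - (wb n).1.1]
      + '[xi (w n - wb n), B1 (t - (wb n).1.1)] - '[(wb n).2, B1 (t - (wb n).1.1)]); last first.
    by apply/funext => n; rewrite 2![in LHS]innerDl innerNl !(adjoint_sym B1_adj).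
  apply: cvgB; last exact: cvg_inner xb (cvg_linear ty).
  by apply: cvgD; [exact: psd_null T1_psd rT1 ty|exact: cvg_inner xir (cvg_linear ty)].
- have sub n : subdiff f2 (wb n).1.2
      (T2 (w n - wb n).1.2 - B2s (wb n).2) by have [] := wP n.
  apply: (subdiff_closed f2p f2lsc zb sub) => t.
  have tz : (fun n => t - (wb n).1.2) @ \oo --> t - z by apply: cvgB => //; exact: cvg_cst.
  have -> : '[- B2s x, t - z] = 0 - '[x, B2 (t - z)].
    by rewrite add0r innerNl (adjoint_sym B2_adj).
  rewrite (_ : (fun n => _) = fun n => '[T2 (w n - wb n).1.2, t - (wb n).1.2]
      - '[(wb n).2, B2 (t - (wb n).1.2)]); last first.
    by apply/funext => n; rewrite [in LHS]innerDl innerNl !(adjoint_sym B2_adj).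
  by apply: cvgB; [exact: psd_null T2_psd rT2 tz|exact: cvg_inner xb (cvg_linear tz)].
(* The residual [xi] has this limit by the third row and the limit 0 by [xir]; uniqueness gives
   feasibility. *)
- have : (fun n => xi (w n - wb n)) @ \oo --> sigma *: (c - B1 y - B2 z).
    rewrite (_ : (fun n => _) = fun n => sigma *: (c - B1 (wb n).1.1 - B2 (wb n).1.2)).
      apply: cvgZl_tmp; apply: cvgB; last exact: cvg_linear.
      by apply: cvgB; [exact: cvg_cst|exact: cvg_linear].
    by apply/funext => n; have [] := wP n.
  move=> /(cvg_unique (@norm_hausdorff _ X) xir)/esym/eqP.
  rewrite scaler_eq0 gt_eqF//= => /eqP H.
  by apply/eqP; rewrite -oppr_eq0 opprB opprD addrA H.
Qed.

End DegenerateProximalPoint.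

(** * Convergence of the algorithm *)

Section Algorithm.
Context {R : realType} {X Y Z : euclideanType R}.
Variables (f1 : Y -> \bar R) (f2 : Z -> \bar R).
Variables (B1 : {linear Y -> X}) (B2 : {linear Z -> X}) (c : X).
Variables (B1s : {linear X -> Y}) (B2s : {linear X -> Z}).
Variables (T1 : {linear Y -> Y}) (T2 : {linear Z -> Z}).
Variables (sigma alpha rho : R) (w wbar what : nat -> Y * Z * X).
Hypotheses (f1_pcc : proper_closed_convex f1) (f2_pcc : proper_closed_convex f2).
Hypotheses (B1_adj : adjoint B1 B1s) (B2_adj : adjoint B2 B2s).
Hypotheses (T1_psd : possemidef T1) (T2_psd : possemidef T2).
Hypothesis alpha_ge2 : 2 <= alpha.
Hypothesis w_pADMM : accelerated_pADMM f1 f2 B1 B2 c T1 T2 sigma alpha rho w wbar what.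

(** The multiplier update makes [xbar] the multiplier in the optimality condition for z; in the one
    for y, the additional penalty term is minus the [xi] residual. *)
Lemma pADMM_prox_image k :
  prox_image f1 f2 B1 B2 c B1s B2s T1 T2 sigma (w k) (wbar k).
Proof.
have [_ _ _ /(_ k)] := w_pADMM.
have [f1p _ f1c] := f1_pcc; have [f2p _ f2c] := f2_pcc.
case: (w k) => [[y z] x]; case: (wbar k) => [[yb zb] xb] [zmin xbE ymin _ _].
have xiE : xi B1 sigma ((y, z, x) - (yb, zb, xb)) = sigma *: (c - B1 yb - B2 zb).
  by apply: inner_inj => h; rewrite /xi/= xbE (linearD B1) (linearN B1) !innerE; ring.
have sz : subdiff f2 zb (T2 (z - zb) - B2s xb).
  have -> : xb = x + sigma *: (B2 zb + (B1 y - c)) by rewrite xbE addrA [B2 zb + _]addrC.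
  apply: (@prox_subdiff _ _ _ f2 B2 B2s T2 sigma f2p f2c B2_adj T2_psd _ _ _ _ 0).
  congr (argmin _ _): zmin; apply/funext => t.
  rewrite /aug_lagrangian/= add0e -addeA -EFinD; congr (_ + _%:E)%E.
  by rewrite addr0 [B2 t + _]addrA [B2 t + _]addrC.
split => //; rewrite xiE /=.
have [b fzb] := subdiff_real f2p sz.
have -> : T1 (y - yb) + B1s (sigma *: (c - B1 yb - B2 zb)) - B1s xb
    = T1 (y - yb) - B1s (xb + sigma *: (B1 yb + (B2 zb - c))).
  apply: inner_inj => h.
  by rewrite !innerE !(adjoint_sym B1_adj) !innerE; ring.
apply: (@prox_subdiff _ _ _ f1 B1 B1s T1 sigma f1p f1c B1_adj T1_psd _ _ _ _ b).
congr (argmin _ _): ymin; apply/funext => t.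
rewrite /aug_lagrangian fzb -!addeA -!EFinD; congr (_ + _%:E)%E.
by rewrite [B1 t + _]addrA; ring.
Qed.

Let F k := rho *: (w k - wbar k).
Let e k := w k.+1 - w k + F k.

(** Since [what k.+1 = w k - F k], [e k] is the gap [w k.+1 - what k.+1], and the last update
    multiplied by [k + alpha] gives the claim. At [k = 0] the coefficient of [e k.-1] vanishes. *)
Lemma pADMM_recurrence k :
  k%:R *: e k.-1 = (k%:R + alpha) *: e k - (alpha / 2) *: F k.
Proof.
have whatS j : what j.+1 = w j - F j.
  have [_ _ _ /(_ j)] := w_pADMM; rewrite /F.
  case: (w j) => [[y z] x]; case: (wbar j) => [[yb zb] xb] [_ _ _ -> _].
  by rewrite scalerBl scale1r scalerBr opprB -addrA [- _ + _]addrC.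
have wS : w k.+1 = w k + (alpha / (2 * (k%:R + alpha))) *: (what k.+1 - w k)
                     + (k%:R / (k%:R + alpha)) *: (what k.+1 - what k).
  have [_ _ _ /(_ k)] := w_pADMM.
  by case: (w k) => [[y z] x]; case: (wbar k) => [[yb zb] xb] [_ _ _ _ ->].
have N0 : k%:R + alpha != 0.
  by rewrite gt_eqF// ltr_wpDl ?ler0n// (lt_le_trans _ alpha_ge2).
have -> : k%:R *: e k.-1 = k%:R *: w k - k%:R *: what k.
  case: (k) => [|j]; first by rewrite !scale0r subrr.
  by rewrite -scalerBr /= whatS /e opprB -addrA [- w j + _]addrC.
have -> : e k = (alpha / (2 * (k%:R + alpha))) *: - F k
    + (k%:R / (k%:R + alpha)) *: (w k - F k - what k) + F k.
  rewrite /e wS !whatS; congr (_ + F k).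
  by rewrite [w k - F k]addrC addrK -[w k + _ + _]addrA [w k + _]addrC addrK.
move: (F k) (w k) (what k) => u v t; rewrite !scalerDr !scalerA.
have -> : (k%:R + alpha) * (alpha / (2 * (k%:R + alpha))) = alpha / 2 by field.
have -> : (k%:R + alpha) * (k%:R / (k%:R + alpha)) = k%:R by field.
have -> : (k%:R + alpha) *: u = k%:R *: u + (alpha / 2) *: u + (alpha / 2) *: u.
  by rewrite -!scalerDl; congr (_ *: _); field.
rewrite !scalerN -addrA addrK [k%:R *: u + _]addrC addrA.
by rewrite [X in X + k%:R *: u]addrAC addNr add0r addrAC subrK.
Qed.

End Algorithm.

Theorem corollary3p5 (R : realType) (X Y Z : euclideanType R)
    (f1 : Y -> \bar R) (f2 : Z -> \bar R)
    (B1 : {linear Y -> X}) (B2 : {linear Z -> X})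
    (B1s : {linear X -> Y}) (B2s : {linear X -> Z}) (c : X)
    (T1 Sigma1 : {linear Y -> Y}) (T2 Sigma2 : {linear Z -> Z})
    (sigma alpha rho : R) (w wbar what : nat -> Y * Z * X)
    (f1_pcc : proper_closed_convex f1) (f2_pcc : proper_closed_convex f2)
    (B1_adj : adjoint B1 B1s) (B2_adj : adjoint B2 B2s)
    (T1_psd : possemidef T1) (T2_psd : possemidef T2)
    (Sigma1_f1 : convexity_modulus f1 Sigma1)
    (Sigma2_f2 : convexity_modulus f2 Sigma2)
    (sigma_gt0 : 0 < sigma) (alpha_ge2 : 2 <= alpha)
    (rho_gt0 : 0 < rho) (rho_le2 : rho <= 2)
    (KKT_nonempty : exists y z x, KKT f1 f2 B1 B2 c B1s B2s y z x)
    (pd1 : posdef (fun y => Sigma1 y + B1s (B1 y) + T1 y))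
    (pd2 : posdef (fun z => Sigma2 z + B2s (B2 z) + T2 z))
    (w_pADMM : accelerated_pADMM f1 f2 B1 B2 c T1 T2 sigma alpha rho
                 w wbar what) :
  exists (ys : Y) (zs : Z) (xs : X),
    [/\ wbar @ \oo --> (ys, zs, xs),
        primal_solution f1 f2 B1 B2 c ys zs
      & dual_solution f1 f2 c B1s B2s xs].
Proof.
pose q := form B1 T1 T2 sigma.
have qC : forall u v, q u v = q v u by exact: formC.
have qDl : forall u v t, q (u + v) t = q u t + q v t by exact: formDl.
have qZl : forall a u v, q (a *: u) v = a * q u v by exact: formZl.
have q_ge0 : forall u, 0 <= q u u by exact: form_ge0.
have qX := qE qC qDl qZl.
have prox := pADMM_prox_image f1_pcc f2_pcc B1_adj B2_adj T1_psd T2_psd w_pADMM.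
pose F k := rho *: (w k - wbar k).
pose e k := w k.+1 - w k + F k.
pose G k := k%:R *: e k.-1.
have GE : forall k, G k = (k%:R + alpha) *: e k - (alpha / 2) *: F k.
  exact: (pADMM_recurrence alpha_ge2 w_pADMM).
have wS k : w k.+1 = w k - F k + e k.
  by rewrite /e [w k.+1 - _ + _]addrC addrA subrK addrC subrK.
have G0 : G 0%N = 0 by rewrite /G scale0r.
have GS k : G k.+1 = k.+1%:R *: e k by [].
(* Nonexpansiveness of the relaxed map: with [r] the residual difference and [d] the image
   difference, monotonicity gives [q r d >= 0], and [rho <= 2] keeps [(2 - rho) * q r r]
   nonnegative. *)
have mono k v vb : prox_image f1 f2 B1 B2 c B1s B2s T1 T2 sigma v vb ->
    q (rho *: ((w k - wbar k) - (v - vb))) (rho *: ((w k - wbar k) - (v - vb)))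
      <= 2 * q (rho *: ((w k - wbar k) - (v - vb))) (w k - v).
  move=> vP.
  have := prox_image_monotone f1_pcc f2_pcc B1_adj B2_adj T1_psd T2_psd
    Sigma1_f1 Sigma2_f2 sigma_gt0 (prox k) vP.
  have -> : w k - v = (w k - wbar k - (v - vb)) + (wbar k - vb).
    by rewrite opprB addrACA subrK [vb - v]addrC addrK.
  rewrite -/q; move: (w k - wbar k - (v - vb)) (wbar k - vb) => r d rd.
  rewrite !qX; have := q_ge0 r.
  move=> rr; rewrite -subr_ge0.
  have -> : 2 * (rho * q r r + rho * q r d) - rho * (rho * q r r)
     = rho * ((2 - rho) * q r r + 2 * q r d) by ring.
  by rewrite mulr_ge0 ?(ltW rho_gt0)// addr_ge0// mulr_ge0// subr_ge0.
have F_coco k : q (F k.+1 - F k) (F k.+1 - F k) <= 2 * q (F k.+1 - F k) (w k.+1 - w k).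
  by rewrite /F -scalerBr; exact: mono.
pose Fix := [set p : Y * Z * X | KKT f1 f2 B1 B2 c B1s B2s p.1.1 p.1.2 p.2].
have FixP p : Fix p -> prox_image f1 f2 B1 B2 c B1s B2s T1 T2 sigma p p.
  by case: p => [[y z] x]; exact: KKT_prox_image.
have F_fix p k : Fix p -> q (F k) (F k) <= 2 * q (F k) (w k - p).
  by move=> /FixP/(mono k); rewrite subrr subr0.
have [y0 [z0 [x0 KKT0]]] := KKT_nonempty.
have Fix0 : Fix (y0, z0, x0) by [].
have [L L_ge0 lip] := prox_image_lipschitz c f1_pcc f2_pcc B1_adj B2_adj T1_psd T2_psd
  Sigma1_f1 Sigma2_f2 sigma_gt0 pd1 pd2.
have r0 : (fun k => q (w k - wbar k) (w k - wbar k)) @ \oo --> (0 : R).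
  have F0 := residual_null qC qDl qZl q_ge0 alpha_ge2 wS G0 GS GE F_coco (F_fix _ ^~ Fix0).
  rewrite (_ : (fun k => _) = fun k => (rho ^+ 2)^-1 * q (F k) (F k)).
    by rewrite -[0](mulr0 (rho ^+ 2)^-1); exact: cvgMl_tmp.
  apply/funext => k; rewrite /F; move: (w k - wbar k) => r; rewrite !qX.
  by field; rewrite gt_eqF.
have [C wC] := dist_bounded qC qDl qZl q_ge0 alpha_ge2 wS G0 GS GE (F_fix _ ^~ Fix0).
have [M [yM zM xM]] : exists M, [/\ forall k, `|(wbar k).1.1| <= M,
    forall k, `|(wbar k).1.2| <= M & forall k, `|(wbar k).2| <= M].
  (* The bound [s <= s ^+ 2 + 1] avoids a square root, whence the [+ 1]. *)
  have norm_bounded (E : euclideanType R) (u : nat -> E) (p : E) :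
      (forall k, `|u k - p| ^+ 2 <= L * q (w k - (y0, z0, x0)) (w k - (y0, z0, x0))) ->
      forall k, `|u k| <= `|p| + (L * C + 1).
    move=> uP k; rewrite -[u k](subrK p) addrC (le_trans (ler_normD _ _))// lerD2l.
    have := uP k; have := ler_wpM2l L_ge0 (wC k); have := normr_ge0 (u k - p).
    by nra.
  exists (`|y0| + `|z0| + `|x0| + (L * C + 1)).
  have [y0_ge0 z0_ge0 x0_ge0] := And3 (normr_ge0 y0) (normr_ge0 z0) (normr_ge0 x0).
  have dist0 k := lip _ _ _ _ (prox k) (FixP _ Fix0).
  split=> k.
  - by apply: le_trans (norm_bounded _ (fun k => (wbar k).1.1) y0 _ k) _;
      [move=> {}k; have [] := dist0 k|lra].
  - by apply: le_trans (norm_bounded _ (fun k => (wbar k).1.2) z0 _ k) _;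
      [move=> {}k; have [] := dist0 k|lra].
  - by apply: le_trans (norm_bounded _ (fun k => (wbar k).2) x0 _ k) _;
      [move=> {}k; have [] := dist0 k|lra].
have cluster (f : nat -> nat) : (forall n, (n <= f n)%N) -> exists p (h : nat -> nat),
    [/\ Fix p, forall n, (n <= h n)%N &
      (fun n => q (w (f (h n)) - p) (w (f (h n)) - p)) @ \oo --> (0 : R)].
  move=> fn.
  (* Successive extractions, one per block, composed into [h]. *)
  have [y [h1 [h1n yh]]] := bounded_subseq (fun n => yM (f n)).
  have [z [h2 [h2n zh]]] := bounded_subseq (fun n => zM (f (h1 n))).
  have [x [h3 [h3n xh]]] := bounded_subseq (fun n => xM (f (h1 (h2 n)))).
  pose h n := h1 (h2 (h3 n)).
  have hn n : (n <= h n)%N.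
    by rewrite /h (leq_trans (h3n n))// (leq_trans (h2n _))// h1n.
  have {}yh : (fun n => (wbar (f (h n))).1.1) @ \oo --> y.
    have h23 n : (n <= h2 (h3 n))%N by rewrite (leq_trans (h3n n)).
    exact: (cvg_comp _ _ (cvg_index h23) yh).
  have {}zh : (fun n => (wbar (f (h n))).1.2) @ \oo --> z.
    exact: (cvg_comp _ _ (cvg_index h3n) zh).
  have fhn n : (n <= f (h n))%N by rewrite (leq_trans (hn n)).
  have rh : (fun n => q (w (f (h n)) - wbar (f (h n))) (w (f (h n)) - wbar (f (h n))))
      @ \oo --> (0 : R) by exact: (cvg_comp _ _ (cvg_index fhn) r0).
  exists (y, z, x), h; split => //.
    apply: (prox_image_closed f1_pcc f2_pcc B1_adj B2_adj T1_psd T2_psd sigma_gt0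
      (w := fun n => w (f (h n))) (wb := fun n => wbar (f (h n)))) => //.
  pose p : Y * Z * X := (y, z, x).
  have ph : (fun n => q (wbar (f (h n)) - p) (wbar (f (h n)) - p)) @ \oo --> (0 : R).
    have sub0 (E : normedModType R) (u : nat -> E) (l : E) :
        u @ \oo --> l -> (fun n => u n - l) @ \oo --> (0 : E).
      by move=> ul; rewrite -(subrr l); apply: cvgB => //; exact: cvg_cst.
    have [dy dz dx] := And3 (sub0 _ _ _ yh) (sub0 _ _ _ zh) (sub0 _ _ _ xh).
    have dxi : (fun n => xi B1 sigma (wbar (f (h n)) - p)) @ \oo --> (0 : X).
      have := cvgD dx (cvgZ (cvg_cst sigma) (cvg_linear (L := B1) dy)).
      by rewrite linear0 scaler0 addr0 => H; exact: H.
    rewrite -[0](_ : '[0, T1 0] + '[0, T2 0] + sigma^-1 * '[0 : X, 0] = _).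
      apply: cvgD; last by apply: cvgMl_tmp; exact: cvg_inner.
      by apply: cvgD; apply: cvg_inner => //; exact: cvg_linear.
    by rewrite !linear0l mulr0 !addr0.
  (* [w - p] splits into the residual and [wbar - p], and [|r + d|^2 <= 2 |r|^2 + 2 |d|^2]. *)
  have two : (fun n => 2 * q (w (f (h n)) - wbar (f (h n))) (w (f (h n)) - wbar (f (h n)))
      + 2 * q (wbar (f (h n)) - p) (wbar (f (h n)) - p)) @ \oo --> (0 : R).
    by rewrite -[0]addr0 -{1 2}(mulr0 2); apply: cvgD; exact: cvgMl_tmp.
  apply: (squeeze_cvgr _ (cvg_cst 0) two); apply: nearW => n; rewrite q_ge0/=.
  have -> : w (f (h n)) - p = w (f (h n)) - wbar (f (h n)) + (wbar (f (h n)) - p).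
    by rewrite addrA subrK.
  move: (w _ - wbar _) (wbar _ - p) => r d.
  by have := q_ge0 (r - d); rewrite !qX (qC d r); lra.
have [[[y z] x] Fp wp] := fast_KM_cvg qC qDl qZl q_ge0 alpha_ge2 wS G0 GS GE F_coco
  (ex_intro _ _ Fix0) F_fix cluster.
exists y, z, x; split.
(* The sequence [w] converges only in the seminorm; [lip], applied with the fixed point as its own
   image, upgrades this to norm convergence of [wbar]. *)
- have cvg0 a : (fun k => a * q (w k - (y, z, x)) (w k - (y, z, x))) @ \oo --> (0 : R).
    by rewrite -[0](mulr0 a); exact: cvgMl_tmp.
  rewrite (_ : wbar = fun k => ((wbar k).1.1, (wbar k).1.2, (wbar k).2)); last first.
    by apply/funext => k; case: (wbar k) => [[]].
  have distp k := lip _ _ _ _ (prox k) (FixP _ Fp).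
  have yc : (fun k => (wbar k).1.1) @ \oo --> y.
    by apply: cvg_sqr_dist (cvg0 L) => k; have [] := distp k.
  have zc : (fun k => (wbar k).1.2) @ \oo --> z.
    by apply: cvg_sqr_dist (cvg0 L) => k; have [] := distp k.
  have xc : (fun k => (wbar k).2) @ \oo --> x.
    by apply: cvg_sqr_dist (cvg0 L) => k; have [] := distp k.
  exact: cvg_pair (cvg_pair yc zc) xc.
- have [f1p _ _] := f1_pcc; have [f2p _ _] := f2_pcc.
  exact: (KKT_primal_solution f1p f2p B1_adj B2_adj Fp).
- have [f1p _ _] := f1_pcc; have [f2p _ _] := f2_pcc.
  exact: (KKT_dual_solution f1p f2p B1_adj B2_adj Fp).
Qed.
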